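(* Let $X$ be a locally compact, separable, metrizable space, $m$ a positive Radon measure on $X$ with full support, and $(\mathcal{E},\mathcal{F})$ a strong local regular Dirichlet form on $L^2(X;m)$ whose index $p$ satisfies $1\le p<\infty$. Let $\nu$ be a minimal energy-dominant measure and $p(x)$ the pointwise index. Equip $\mathcal{F}^p$ (the $p$-fold product of $\mathcal{F}$) with the product topology, where $\mathcal{F}$ carries the Hilbert norm from $(f,g)_{\mathcal{F}}=\mathcal{E}(f,g)+\int_X fg\,dm$. Define $$\mathcal{G}=\Big\{(g_1,\dots,g_p)\in\mathcal{F}^p : \text{for }\nu\text{-a.e. }x\in X,\ \text{the } p(x)\times p(x)\text{ matrix }\Big(\tfrac{d\mu_{\langle g_i,g_j\rangle}}{d\nu}(x)\Big)_{i,j=1}^{p(x)}\text{ is invertible}\Big\},$$ $$\hat{\mathcal{G}}=\{(g_1,\dots,g_p)\in\mathcal{G} : \mu_{\langle g_i\rangle}\text{ is a minimal energy-dominant measure for every } i=1,\dots,p\}.$$ Then $\mathcal{G}$ and $\hat{\mathcal{G}}$ are dense in $\mathcal{F}^p$.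
   Context: Strong locality: $\mathcal{E}(f,g)=0$ whenever $f,g\in\mathcal{F}$ have compact supports and $g$ is constant on a neighborhood of $\mathrm{supp}[f]$ (the support of $|f|\cdot m$). For bounded $f\in\mathcal{F}$, the energy measure $\mu_{\langle f\rangle}$ is the Borel measure with $\int_X\varphi\,d\mu_{\langle f\rangle}=2\mathcal{E}(f\varphi,f)-\mathcal{E}(\varphi,f^2)$ for all $\varphi\in\mathcal{F}\cap C_c(X)$; it extends to all $f\in\mathcal{F}$ by approximation, and $\mu_{\langle f,g\rangle}=\frac12(\mu_{\langle f+g\rangle}-\mu_{\langle f\rangle}-\mu_{\langle g\rangle})$. A $\sigma$-finite Borel measure $\nu$ is a minimal energy-dominant measure (m.e.d.m.) if (a) $\mu_{\langle f\rangle}\ll\nu$ for every $f\in\mathcal{F}$, and (b) every $\sigma$-finite Borel measure $\nu'$ satisfying (a) satisfies $\nu\ll\nu'$. The pointwise index $p(x)$ is the $\nu$-a.e. smallest $\nu$-measurable $\mathbb{Z}_+\cup\{+\infty\}$-valued function such that for all $N$ and $f_1,\dots,f_N\in\mathcal{F}$, $\mathrm{rank}\big(\frac{d\mu_{\langle f_i,f_j\rangle}}{d\nu}(x)\big)_{i,j=1}^N\le p(x)$ for $\nu$-a.e. $x$; the index is $p=\nu\text{-}\operatorname{ess\,sup}_x p(x)$. These notions do not depend on the choice of $\nu$. *)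

(* Defs.v *)
From HB Require Import structures.
From mathcomp Require Import all_boot all_order all_algebra.
From mathcomp Require Import all_classical all_reals all_analysis.
From mathcomp Require Import measurable_realfun ess_sup_inf.
Set Implicit Arguments. Unset Strict Implicit. Unset Printing Implicit Defensive.
Import Order.TTheory GRing.Theory Num.Theory.
Import numFieldNormedType.Exports.
Local Open Scope classical_set_scope.
Local Open Scope ring_scope.

Definition borel (X : ptopologicalType) := g_sigma_algebraType (@open X).

Section dirichlet.
Context (R : realType) (X : ptopologicalType).
Local Notation T := (borel X).

Definition metrizable : Prop :=
  exists dist : X -> X -> R,
    [/\ (forall x y, 0 <= dist x y),
        (forall x y, dist x y = 0 <-> x = y),
        (forall x y, dist x y = dist y x),
        (forall x y z, dist x z <= dist x y + dist y z) &
        (forall U : set X, open U <->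
           (forall x, U x -> exists2 r : R, 0 < r & [set y | dist x y < r] `<=` U))].

Definition separable_space : Prop :=
  exists D : set X, countable D /\ closure D = setT.

(** A positive Radon measure with full support (on a locally compact separable
    metrizable space, locally finite Borel measures are Radon). *)
Definition radon_full_support (m : {measure set T -> \bar R}) : Prop :=
  (forall K : set X, compact K -> (m K < +oo)%E) /\
  (forall U : set X, open U -> U !=set0 -> (0 < m U)%E).

(** L^2 (functions are representatives of m-classes). *)
Definition sqint (m : {measure set T -> \bar R}) (f : X -> R) : Prop :=
  measurable_fun [set: T] (f : T -> R) /\
  (\int[m]_x ((f x) ^+ 2)%:E < +oo)%E.

Definition L2sq (m : {measure set T -> \bar R}) (f : X -> R) : R :=
  fine (\int[m]_x ((f x) ^+ 2)%:E).

Definition E1 (m : {measure set T -> \bar R}) (E : (X -> R) -> (X -> R) -> R)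
  (u : X -> R) : R := E u u + L2sq m u.

Definition ess_bounded (m : {measure set T -> \bar R}) (f : X -> R) : Prop :=
  exists M : R, {ae m, forall x : T, `|f x| <= M}.

Definition Cc (f : X -> R) : Prop :=
  continuous f /\ compact (closure [set x | f x != 0]).

(** supp[f] = support of the measure |f| . m *)
Definition fsupp (m : {measure set T -> \bar R}) (f : X -> R) : set X :=
  [set x | forall U : set X, open U -> U x ->
     (0 < \int[m]_(y in (U : set T)) (`|f y|)%:E)%E].

Definition L2_subspace (m : {measure set T -> \bar R})
  (E : (X -> R) -> (X -> R) -> R) (F : set (X -> R)) : Prop :=
  [/\
      (forall f, F f -> sqint m f),
      [/\ F (fun=> 0),
          (forall f g, F f -> F g -> F (f \+ g)) &
          (forall (c : R) f, F f -> F (fun x => c * f x))],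
      (forall f g, F f -> measurable_fun [set: T] (g : T -> R) ->
          {ae m, forall x : T, f x = g x} ->
          F g /\ forall h, F h -> E f h = E g h) &
      (forall h, sqint m h -> forall eps : R, 0 < eps ->
          exists2 f, F f & L2sq m (f \- h) < eps)].

Definition dirichlet_form (m : {measure set T -> \bar R})
  (E : (X -> R) -> (X -> R) -> R) (F : set (X -> R)) : Prop :=
  [/\ L2_subspace m E F,
      [/\ (forall f g, F f -> F g -> E f g = E g f),
          (forall f g h, F f -> F g -> F h -> E (f \+ g) h = E f h + E g h),
          (forall (c : R) f h, F f -> F h -> E (fun x => c * f x) h = c * E f h) &
          (forall f, F f -> 0 <= E f f)],
      (forall u : nat -> X -> R, (forall n, F (u n)) ->
          (forall eps : R, 0 < eps -> exists N, forall k l, (N <= k)%N -> (N <= l)%N ->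
              E1 m E (u k \- u l) < eps) ->
          exists2 f, F f & (fun n => E1 m E (u n \- f)) @ \oo --> (0 : R)) &
      (forall f, F f ->
          let g := fun x => Num.min (Num.max (f x) 0) 1 in F g /\ E g g <= E f f)].

Definition regular_form (m : {measure set T -> \bar R})
  (E : (X -> R) -> (X -> R) -> R) (F : set (X -> R)) : Prop :=
  (forall f, F f -> forall eps : R, 0 < eps ->
      exists2 phi, F phi /\ Cc phi & E1 m E (f \- phi) < eps) /\
  (forall psi, Cc psi -> forall eps : R, 0 < eps ->
      exists2 phi, F phi /\ Cc phi & forall x, `|phi x - psi x| < eps).

Definition strongly_local (m : {measure set T -> \bar R})
  (E : (X -> R) -> (X -> R) -> R) (F : set (X -> R)) : Prop :=
  forall f g, F f -> F g -> compact (fsupp m f) -> compact (fsupp m g) ->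
    (exists U : set X, exists c : R,
        [/\ open U, fsupp m f `<=` U & {ae m, forall x : T, U x -> g x = c}]) ->
    E f g = 0.

Definition energy_measures (m : {measure set T -> \bar R})
  (E : (X -> R) -> (X -> R) -> R) (F : set (X -> R))
  (mu : (X -> R) -> {measure set T -> \bar R}) : Prop :=
  [/\ (forall f, F f -> (mu f setT < +oo)%E),
      (forall f, F f -> ess_bounded m f -> forall phi, F phi -> Cc phi ->
          (\int[mu f]_x (phi x)%:E = (2 * E (f \* phi) f - E phi (f \* f))%:E)%E) &
      (forall f, F f -> forall u : nat -> X -> R,
          (forall n, F (u n) /\ ess_bounded m (u n)) ->
          (fun n => E1 m E (u n \- f)) @ \oo --> (0 : R) ->
          forall A : set T, measurable A ->
          (fun n => mu (u n) A) @ \oo --> mu f A)].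

Definition medm (F : set (X -> R)) (mu : (X -> R) -> {measure set T -> \bar R})
  (nu : {measure set T -> \bar R}) : Prop :=
  [/\ sigma_finite [set: T] nu,
      (forall f, F f -> mu f `<< nu) &
      (forall nu' : {measure set T -> \bar R}, sigma_finite [set: T] nu' ->
          (forall f, F f -> mu f `<< nu') -> nu `<< nu')].

Definition densities (F : set (X -> R)) (mu : (X -> R) -> {measure set T -> \bar R})
  (nu : {measure set T -> \bar R}) (rho : (X -> R) -> X -> R) : Prop :=
  forall f, F f ->
    [/\ measurable_fun [set: T] (rho f : T -> R),
        (forall x, 0 <= rho f x) &
        (forall A : set T, measurable A ->
            (mu f A = \int[nu]_(x in A) (rho f x)%:E)%E)].

(** d mu_<f,g> / d nu, with mu_<f,g> = (mu_<f+g> - mu_<f> - mu_<g>)/2. *)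
Definition mdens (rho : (X -> R) -> X -> R) (f g : X -> R) (x : X) : R :=
  (rho (f \+ g) x - rho f x - rho g x) / 2.

Definition emat (rho : (X -> R) -> X -> R) (N : nat) (fs : 'I_N -> X -> R) (x : X)
  : 'M[R]_N := \matrix_(i, j) mdens rho (fs i) (fs j) x.

Definition pw_index_bound (F : set (X -> R)) (nu : {measure set T -> \bar R})
  (rho : (X -> R) -> X -> R) (q : T -> \bar R) : Prop :=
  [/\ measurable_fun [set: T] q,
      (forall x, q x = +oo%E \/ exists n : nat, q x = (n%:R)%:E) &
      (forall N (fs : 'I_N -> X -> R), (forall i, F (fs i)) ->
          {ae nu, forall x : T, ((\rank (emat rho fs x))%:R%:E <= q x)%E})].

Definition pointwise_index (F : set (X -> R)) (nu : {measure set T -> \bar R})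
  (rho : (X -> R) -> X -> R) (q : T -> \bar R) : Prop :=
  pw_index_bound F nu rho q /\
  (forall q', pw_index_bound F nu rho q' -> {ae nu, forall x : T, (q x <= q' x)%E}).

(** The set G: (g_0, ..., g_{p-1}) in F^p (encoded as g : nat -> X -> R, only the
    first p components matter) such that nu-a.e. the p(x) x p(x) matrix
    (d mu_<g_i,g_j>/d nu (x))_{i,j < p(x)} is invertible. *)
Definition setG (F : set (X -> R)) (nu : {measure set T -> \bar R})
  (rho : (X -> R) -> X -> R) (q : T -> \bar R) (p : nat) (g : nat -> X -> R) : Prop :=
  (forall i, (i < p)%N -> F (g i)) /\
  {ae nu, forall x : T, forall n : nat, q x = (n%:R)%:E ->
      (\matrix_(i < n, j < n) mdens rho (g i) (g j) x) \in unitmx}.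

Definition setGhat (F : set (X -> R)) (mu : (X -> R) -> {measure set T -> \bar R})
  (nu : {measure set T -> \bar R})
  (rho : (X -> R) -> X -> R) (q : T -> \bar R) (p : nat) (g : nat -> X -> R) : Prop :=
  setG F nu rho q p g /\ (forall i, (i < p)%N -> medm F mu (mu (g i))).

Definition dense_in_Fp (m : {measure set T -> \bar R})
  (E : (X -> R) -> (X -> R) -> R) (F : set (X -> R)) (p : nat)
  (S : (nat -> X -> R) -> Prop) : Prop :=
  forall f : nat -> X -> R, (forall i, (i < p)%N -> F (f i)) ->
  forall eps : R, 0 < eps ->
  exists2 g, S g & forall i, (i < p)%N -> E1 m E (f i \- g i) < eps.

End dirichlet.

(* Main.v *)
Require Import Defs.
From HB Require Import structures.
From mathcomp Require Import all_boot all_order all_algebra.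
From mathcomp Require Import all_classical all_reals all_analysis.
From mathcomp Require Import measurable_realfun ess_sup_inf.
From mathcomp Require Import ring lra.
Import Order.TTheory GRing.Theory Num.Theory.
Import numFieldNormedType.Exports.
Local Open Scope classical_set_scope.
Local Open Scope ring_scope.
Set Implicit Arguments. Unset Strict Implicit. Unset Printing Implicit Defensive.

(** Write D(f,g) = d mu_<f,g> / d nu.  Almost everywhere D is a nonnegative
    symmetric bilinear form: on F /\ C_c this is read off the defining formula of
    the energy measures (products of bounded functions of F lie in F by the unit
    contraction), and it passes to F by continuity.  For a tuple h let good h be the
    set of points x where the leading p(x) x p(x) minor of (D(h_i,h_j)) and all
    D(h_i,h_i) are nonzero, and measure it by a finite measure kap equivalent to nu.
    The map h |-> kap (good h) is lower semicontinuous, and since minors of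
    h + t g are polynomials in t, good (h + t g) exhausts good g as t -> 0.  A Baire
    argument thus yields a dense set of h maximizing kap (good h).  For such h the
    complement of good h is null: on it every p(x) x p(x) Gram minor would vanish, so
    the pointwise index could be lowered by one there. *)

(** * Dirichlet forms as Hilbert norms *)

(** Two obstacles shape the argument. The pairing D is bilinear and satisfies the Cauchy-Schwarz
    inequality only outside a null set that depends on the functions and scalars involved, so every
    pointwise step uses countably many of them: perturbations h + g/(k+1), Young inequalities with
    integer weights, minors indexed by finite lists. Moreover, unit contraction is the only
    nonlinear operation granted on F, so the products needed to polarize the defining formula must
    be built: u^2 is an E1-limit of piecewise linear functions of u, whose energies are controlled
    because slices of u at different heights have nonnegative mutual energy. Finiteness of [kap]
    makes the supremum of [kap (good h)] finite and turns almost everywhere statements along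
    sequences into small measures. Asking for nonzero diagonal densities lets the same tuples serve
    both density statements, since a nonvanishing density of mu_<h_i> makes nu absolutely continuous
    with respect to it. *)

Section quadratic_L2.
Context (R : realType) (X : ptopologicalType).
Local Notation T := (borel X).
Context (m : {measure set T -> \bar R}).
Implicit Types f g : X -> R.

Lemma measurable_sqr_EFin (f : X -> R) : measurable_fun [set: T] (f : T -> R) ->
  measurable_fun [set: T] (fun x : T => (f x ^+ 2)%:E).
Proof. by move=> mf; apply/measurable_EFinP; exact: measurable_funX. Qed.

Lemma sqint_le f g (c : R) : 0 <= c -> sqint m g ->
  measurable_fun [set: T] (f : T -> R) ->
  (forall x, `|f x| <= c * `|g x|) -> sqint m f /\ L2sq m f <= c ^+ 2 * L2sq m g.
Proof.
move=> c0 [mg gi] mf fg.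
have le : (\int[m]_x ((f x) ^+ 2)%:E <= (c ^+ 2)%:E * \int[m]_x ((g x) ^+ 2)%:E)%E.
  rewrite -ge0_integralZl_EFin//=.
  - apply: ge0_le_integral => //=.
    + by move=> x _; rewrite lee_fin sqr_ge0.
    + exact: measurable_sqr_EFin.
    + by apply/measurable_EFinP; apply: measurable_funM => //; exact: measurable_funX.
    + move=> x _; rewrite -EFinM lee_fin -(real_normK (num_real (f x))).
      rewrite -(real_normK (num_real (g x))) -exprMn.
      by rewrite lerXn2r// nnegrE mulr_ge0.
  - by move=> x _; rewrite lee_fin sqr_ge0.
  - exact: measurable_sqr_EFin.
  - exact: sqr_ge0.
have g0 : (0 <= \int[m]_x ((g x) ^+ 2)%:E)%E.
  by apply: integral_ge0 => x _; rewrite lee_fin sqr_ge0.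
have f0 : (0 <= \int[m]_x ((f x) ^+ 2)%:E)%E.
  by apply: integral_ge0 => x _; rewrite lee_fin sqr_ge0.
have fi : (\int[m]_x ((f x) ^+ 2)%:E < +oo)%E.
  by apply: le_lt_trans le _; apply: lte_mul_pinfty => //; rewrite lee_fin sqr_ge0.
split; first by split.
rewrite -lee_fin EFinM /L2sq fineK; last by rewrite ge0_fin_numE.
by rewrite fineK// ge0_fin_numE.
Qed.

Lemma L2sq_ge0 f : 0 <= L2sq m f.
Proof. by apply/fine_ge0/integral_ge0 => x _; rewrite lee_fin sqr_ge0. Qed.

Lemma sqintD f g : sqint m f -> sqint m g ->
  sqint m (f \+ g) /\ L2sq m (f \+ g) <= 2 * L2sq m f + 2 * L2sq m g.
Proof.
move=> [mf fi] [mg gi].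
have mfg : measurable_fun [set: T] ((f \+ g : X -> R) : T -> R).
  exact: measurable_funD.
have f0 : (0 <= \int[m]_x ((f x) ^+ 2)%:E)%E.
  by apply: integral_ge0 => x _; rewrite lee_fin sqr_ge0.
have g0 : (0 <= \int[m]_x ((g x) ^+ 2)%:E)%E.
  by apply: integral_ge0 => x _; rewrite lee_fin sqr_ge0.
have fg0 : (0 <= \int[m]_x (((f \+ g) x) ^+ 2)%:E)%E.
  by apply: integral_ge0 => x _; rewrite lee_fin sqr_ge0.
have le : (\int[m]_x (((f \+ g) x) ^+ 2)%:E <=
    2%:E * \int[m]_x ((f x) ^+ 2)%:E + 2%:E * \int[m]_x ((g x) ^+ 2)%:E)%E.
  have sq0 h : forall x : T, [set: T] x -> (0 <= (h x ^+ 2)%:E :> \bar R)%E.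
    by move=> x _; rewrite lee_fin sqr_ge0.
  have sq20 h : forall x : T, [set: T] x -> (0 <= 2%:E * (h x ^+ 2)%:E :> \bar R)%E.
    by move=> x _; rewrite -EFinM lee_fin mulr_ge0 ?sqr_ge0.
  rewrite -!ge0_integralZl_EFin//=; try exact: (measurable_sqr_EFin mf);
    try exact: (measurable_sqr_EFin mg); try exact: sq0.
  have m2 (h : X -> R) : measurable_fun [set: T] (h : T -> R) ->
      measurable_fun [set: T] (fun x : T => (2%:E * (h x ^+ 2)%:E)%E).
    by move=> mh; apply/measurable_EFinP; apply: measurable_funM => //; exact: measurable_funX.
  rewrite -ge0_integralD//=; try exact: (m2 _ mf); try exact: (m2 _ mg);
    try exact: sq20.
  apply: ge0_le_integral => //=.
  - exact: sq0.
  - exact: measurable_sqr_EFin.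
  - by apply: emeasurable_funD; exact: m2.
  - move=> x _; rewrite -!EFinM -EFinD lee_fin -subr_ge0.
    rewrite (_ : _ - _ = (f x - g x) ^+ 2) ?sqr_ge0//; ring.
have fgi : (\int[m]_x (((f \+ g) x) ^+ 2)%:E < +oo)%E.
  apply: le_lt_trans le _; apply: lte_add_pinfty;
    by apply: lte_mul_pinfty => //; rewrite lee_fin.
split; first by split.
rewrite -lee_fin EFinD !EFinM /L2sq !fineK// ge0_fin_numE//.
Qed.

Lemma sqintZ f (c : R) : sqint m f ->
  sqint m (fun x => c * f x) /\ L2sq m (fun x => c * f x) = c ^+ 2 * L2sq m f.
Proof.
move=> fs; have [mf fi] := fs.
have mcf : measurable_fun [set: T] ((fun x => c * f x : R) : T -> R).
  exact: measurable_funM.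
have [||||cs _] := @sqint_le (fun x => c * f x) f `|c| => //.
  by move=> x; rewrite normrM.
split => //.
have f0 : (0 <= \int[m]_x ((f x) ^+ 2)%:E)%E.
  by apply: integral_ge0 => x _; rewrite lee_fin sqr_ge0.
rewrite /L2sq; transitivity (fine (\int[m]_x ((c ^+ 2)%:E * (f x ^+ 2)%:E)))%E.
  by congr fine; apply: eq_integral => x _; rewrite exprMn EFinM.
rewrite ge0_integralZl_EFin//=.
- by rewrite fineM// ge0_fin_numE.
- by move=> x _; rewrite lee_fin sqr_ge0.
- exact: measurable_sqr_EFin.
- exact: sqr_ge0.
Qed.

Lemma L2sq_eq0 f : sqint m f -> L2sq m f = 0 -> {ae m, forall x : T, f x = 0}.
Proof.
move=> [mf fi] f0.
have f0' : (0 <= \int[m]_x ((f x) ^+ 2)%:E)%E.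
  by apply: integral_ge0 => x _; rewrite lee_fin sqr_ge0.
have : (\int[m]_(x in [set: T]) `|(f x ^+ 2)%:E| = 0)%E.
  under eq_integral do rewrite gee0_abs ?lee_fin ?sqr_ge0//.
  by rewrite -[LHS]fineK ?ge0_fin_numE// -[X in X = _]/((L2sq m f)%:E) f0.
move/(ae_eq_integral_abs _ measurableT (measurable_sqr_EFin mf)).
apply: filterS => x /(_ I) /= [] /eqP; rewrite sqrf_eq0 => /eqP //.
Qed.

End quadratic_L2.

(** * The form as a closed quadratic form: quasi-triangle inequality and completeness *)

Section form_algebra.
Context (R : realType) (X : ptopologicalType).
Local Notation T := (borel X).
Context (m : {measure set T -> \bar R}) (E : (X -> R) -> (X -> R) -> R).
Context (F : set (X -> R)) (hF : dirichlet_form m E F).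
Implicit Types f g h u : X -> R.

Lemma form_sqint f : F f -> sqint m f.
Proof. by case: hF => -[+ _ _ _] _ _ _; exact. Qed.

Lemma form0 : F (fun=> 0).
Proof. by case: hF => -[_ [] ]. Qed.

Lemma formD f g : F f -> F g -> F (f \+ g).
Proof. by case: hF => -[_ [_ + _] _ _] _ _ _; exact. Qed.

Lemma formZ (c : R) f : F f -> F (fun x => c * f x).
Proof. by case: hF => -[_ [_ _ +] _ _] _ _ _; exact. Qed.

Lemma formB f g : F f -> F g -> F (f \- g).
Proof.
move=> Ff Fg; rewrite (_ : f \- g = f \+ (fun x => -1 * g x)).
  by apply: formD => //; exact: formZ.
by apply/funext => x /=; rewrite mulN1r.
Qed.

Lemma form_ae f g : F f -> measurable_fun [set: T] (g : T -> R) ->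
  {ae m, forall x : T, f x = g x} -> F g.
Proof.
by case: hF => -[_ _ H _] _ _ _ Ff mg fg; have [] := H _ _ Ff mg fg.
Qed.

Lemma formC f g : F f -> F g -> E f g = E g f.
Proof. by case: hF => _ [+ _ _ _] _ _; exact. Qed.

Lemma formDl f g h : F f -> F g -> F h -> E (f \+ g) h = E f h + E g h.
Proof. by case: hF => _ [_ + _ _] _ _; exact. Qed.

Lemma formZl (c : R) f h : F f -> F h -> E (fun x => c * f x) h = c * E f h.
Proof. by case: hF => _ [_ _ + _] _ _; exact. Qed.

Lemma formDr f g h : F f -> F g -> F h -> E h (f \+ g) = E h f + E h g.
Proof.
by move=> *; rewrite formC ?formDl ?(formC (g := h))//; exact: formD.
Qed.

Lemma formZr (c : R) f h : F f -> F h -> E h (fun x => c * f x) = c * E h f.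
Proof. by move=> *; rewrite formC ?formZl ?(formC (g := h))//; exact: formZ. Qed.

Lemma form_ge0 f : F f -> 0 <= E f f.
Proof. by case: hF => _ [_ _ _ +] _ _; exact. Qed.

Lemma form_sum (N : nat) (v : nat -> X -> R) (s : nat -> R) : (forall k, F (v k)) ->
  F (fun x => \sum_(k < N) s k * v k x).
Proof.
move=> Fv; elim: N => [|N IH].
  by rewrite (_ : (fun _ => _) = (fun=> 0)); [exact: form0|apply/funext => x; rewrite big_ord0].
rewrite (_ : (fun _ => _) = (fun x => \sum_(k < N) s k * v k x) \+ (fun x => s N * v N x)).
  by apply: formD => //; exact: formZ.
by apply/funext => x; rewrite big_ord_recr.
Qed.

Lemma form_suml (N : nat) (v : nat -> X -> R) (s : nat -> R) h :
  (forall k, F (v k)) -> F h ->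
  E (fun x => \sum_(k < N) s k * v k x) h = \sum_(k < N) s k * E (v k) h.
Proof.
move=> Fv Fh; elim: N => [|N IH].
  rewrite big_ord0 (_ : (fun _ => _) = (fun x => 0 * h x)) ?formZl ?mul0r//.
  by apply/funext => x; rewrite big_ord0 mul0r.
rewrite (_ : (fun _ => _) = (fun x => \sum_(k < N) s k * v k x) \+ (fun x => s N * v N x)).
  by rewrite formDl ?formZl ?IH ?big_ord_recr//; [exact: form_sum|exact: formZ].
by apply/funext => x; rewrite big_ord_recr.
Qed.

Lemma formDD f g : F f -> F g -> E (f \+ g) (f \+ g) = E f f + 2 * E f g + E g g.
Proof.
move=> Ff Fg; have Ffg := formD Ff Fg.
by rewrite formDl// !formDr// (formC Fg Ff); ring.
Qed.

Lemma formDD_le f g : F f -> F g -> E (f \+ g) (f \+ g) <= 2 * E f f + 2 * E g g.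
Proof.
move=> Ff Fg; have := form_ge0 (formB Ff Fg).
rewrite (_ : f \- g = f \+ (fun x => -1 * g x)).
  have Fg' := formZ (-1) Fg.
  by rewrite !formDD// !formZl// !formZr//; lra.
by apply/funext => x /=; rewrite mulN1r.
Qed.

Lemma E1_ge0 f : F f -> 0 <= E1 m E f.
Proof. by move=> Ff; rewrite addr_ge0 ?form_ge0 ?L2sq_ge0. Qed.

(** [E1] is the square of the Hilbert norm, so the triangle inequality takes this form with factor
    2; square roots are avoided throughout. *)
Lemma E1D_le f g : F f -> F g -> E1 m E (f \+ g) <= 2 * E1 m E f + 2 * E1 m E g.
Proof.
move=> Ff Fg; have := formDD_le Ff Fg.
have [_] := sqintD (form_sqint Ff) (form_sqint Fg); rewrite /E1; lra.
Qed.

Lemma E1Z (c : R) f : F f -> E1 m E (fun x => c * f x) = c ^+ 2 * E1 m E f.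
Proof.
move=> Ff; rewrite /E1 formZl ?formZr//; last exact: formZ.
have [_ ->] := sqintZ c (form_sqint Ff); ring.
Qed.

Lemma E1BC f g : F f -> F g -> E1 m E (f \- g) = E1 m E (g \- f).
Proof.
move=> Ff Fg; rewrite (_ : f \- g = (fun x => -1 * (g \- f) x)).
  by rewrite E1Z ?sqrrN ?expr1n ?mul1r//; exact: formB.
by apply/funext => x /=; ring.
Qed.

Lemma E1B_le f g h : F f -> F g -> F h ->
  E1 m E (f \- h) <= 2 * E1 m E (f \- g) + 2 * E1 m E (g \- h).
Proof.
move=> Ff Fg Fh; rewrite (_ : f \- h = (f \- g) \+ (g \- h)).
  by apply: E1D_le; exact: formB.
by apply/funext => x /=; ring.
Qed.

(* If the successive E1-distances are below r_k with r_(k+1) <= r_k / 4, the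
   factor 2 of the quasi-triangle inequality is absorbed. *)
Lemma E1_geometric_bound (u : nat -> X -> R) (r : nat -> R) :
  (forall k, F (u k)) -> (forall k, E1 m E (u k \- u k.+1) <= r k) ->
  (forall k, 4 * r k.+1 <= r k) ->
  forall k l, (k <= l)%N -> E1 m E (u k \- u l) <= 4 * r k.
Proof.
move=> Fu ur r4 k l /subnK <-; move: (l - k)%N => {l} d.
have r0 j : 0 <= r j by apply: le_trans (ur j); apply/E1_ge0/formB.
elim: d k => [|d IH] k.
  rewrite add0n (_ : u k \- u k = (fun x => 0 * u k x)).
    by rewrite E1Z// expr0n mul0r mulr_ge0.
  by apply/funext => x /=; rewrite subrr mul0r.
have := E1B_le (Fu k) (Fu k.+1) (Fu (d + k.+1)%N).
have := IH k.+1; have := ur k; have := r4 k; rewrite addnS addSn; lra.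
Qed.

(** Completeness provides the limit. The constant 8 is 2 * 4: the bound 4 * r k to a far term,
    doubled by the quasi-triangle inequality. *)
Lemma E1_geometric_limit (u : nat -> X -> R) (r : nat -> R) :
  (forall k, F (u k)) -> (forall k, E1 m E (u k \- u k.+1) <= r k) ->
  (forall k, 4 * r k.+1 <= r k) ->
  exists2 v, F v & (E1 m E (u n \- v) @[n --> \oo] --> (0 : R)) /\
    forall k, E1 m E (u k \- v) <= 8 * r k.
Proof.
move=> Fu ur r4; have bnd := E1_geometric_bound Fu ur r4.
have r0 j : 0 <= r j by apply: le_trans (ur j); apply/E1_ge0/formB.
have rgeo k : r k <= (4^-1) ^+ k * r 0%N.
  by elim: k => [|k IH]; rewrite ?expr0 ?mul1r// exprS -mulrA; have := r4 k; lra.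
have rcvg : r k @[k --> \oo] --> (0 : R).
  apply: (@squeeze_cvgr _ _ _ _ (cst 0) (fun k => (4^-1) ^+ k * r 0%N)).
  - by near=> k; rewrite /= r0 rgeo.
  - exact: cvg_cst.
  - rewrite -[X in _ --> X](mul0r (r 0%N)); apply: cvgMl.
    by apply: cvg_expr; rewrite ger0_norm; lra.
case: hF => _ _ /(_ u Fu) cplt _.
have /cplt[v Fv uv] : forall eps : R, 0 < eps -> exists N, forall k l,
    (N <= k)%N -> (N <= l)%N -> E1 m E (u k \- u l) < eps.
  move=> e e0; have e4 : 0 < e / 4 by lra.
  have /cvgrPdist_lt/(_ _ e4)[N _ HN] := rcvg.
  have rN k : (N <= k)%N -> r k < e / 4.
    by move=> /HN /=; rewrite sub0r normrN ger0_norm.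
  exists N => k l Nk Nl; have [kl|/ltnW lk] := leqP k l.
    by apply: le_lt_trans (bnd _ _ kl) _; have := rN _ Nk; lra.
  rewrite E1BC//.
  by apply: le_lt_trans (bnd _ _ lk) _; have := rN _ Nl; lra.
exists v => //; split => // k; rewrite leNgt; apply/negP => rk.
(* Half of the excess over 8 * r k: once u l is within d of v, the quasi-triangle inequality through
   u l contradicts the excess. *)
pose d := (E1 m E (u k \- v) - 8 * r k) / 2.
have d0 : 0 < d by rewrite /d; lra.
have /cvgrPdist_lt/(_ _ d0)[N _ HN] := uv.
pose l := maxn N k.
have := HN l (leq_maxl _ _); rewrite /= sub0r normrN ger0_norm; last exact/E1_ge0/formB.
have := bnd k l (leq_maxr _ _).
have := E1B_le (Fu k) (Fu l) Fv; rewrite /d; lra.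
Unshelve. all: by end_near.
Qed.

(** Unit contraction applied to f / c; homogeneity of E carries the bound back. *)
Lemma form_cut f (c : R) : F f -> 0 < c ->
  let g := fun x => Num.min (Num.max (f x) 0) c in F g /\ E g g <= E f f.
Proof.
move=> Ff c0 g; case: hF => _ _ _ /(_ _ (formZ c^-1 Ff)) /= [].
set g1 := (fun _ => _) => Fg1 le1.
have gE : g = (fun x => c * g1 x).
  apply/funext => x; rewrite /g /g1 minr_pMr ?ltW// maxr_pMr ?ltW// mulr0 mulr1.
  by rewrite mulrA divff ?mul1r// gt_eqF.
have le2 : E g1 g1 <= c^-1 ^+ 2 * E f f.
  by apply: le_trans le1 _; rewrite formZl ?formZr// ?mulrA//; exact: formZ.
rewrite gE; split; first exact: formZ.
rewrite formZl ?formZr//; last exact: formZ.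
have -> : E f f = c * (c * (c^-1 ^+ 2 * E f f)) by field; rewrite gt_eqF.
by rewrite !ler_pM2l.
Qed.

End form_algebra.

(** * Bounded functions of a Dirichlet form constitute an algebra *)

Section layers.
Context (R : realType) (X : ptopologicalType).
Local Notation T := (borel X).
Implicit Types (u : X -> R) (d a : R).

Definition clamp a c : R := Num.min (Num.max a 0) c.

(** The slice of u between heights k d and (k+1) d. Functions that are piecewise linear in u with
    nodes k d are linear combinations of slices, the coefficients being the slopes. *)
Definition layer d (k : nat) u (x : X) : R := clamp (u x - k%:R * d) d.

Lemma clamp_cases a c : 0 <= c ->
  [\/ a <= 0 /\ clamp a c = 0, [/\ 0 <= a, a <= c & clamp a c = a] |
      c <= a /\ clamp a c = c].
Proof.
move=> c0; rewrite /clamp; case: (leP a 0) => [a0|a0].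
  by rewrite min_l//; apply: Or31.
case: (leP a c) => ac; first by apply: Or32; rewrite ltW.
by apply: Or33; rewrite ltW.
Qed.

Lemma layerE d k u x : 0 < d ->
  layer d k u x = clamp (u x) (k.+1%:R * d) - clamp (u x) (k%:R * d).
Proof.
move=> d0; have k0 : 0 <= k%:R * d by rewrite mulr_ge0// ltW.
have k1 : k.+1%:R * d = k%:R * d + d by rewrite -natr1 mulrDl mul1r.
have k10 : 0 <= k.+1%:R * d by rewrite mulr_ge0// ltW.
rewrite /layer.
by case: (clamp_cases (u x - k%:R * d) (ltW d0)) => [[? ->]|[? ? ->]|[? ->]];
  case: (clamp_cases (u x) k0) => [[? ->]|[? ? ->]|[? ->]];
  case: (clamp_cases (u x) k10) => [[? ->]|[? ? ->]|[? ->]]; lra.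
Qed.

Lemma layer_ge0 d k u x : 0 < d -> 0 <= layer d k u x.
Proof.
by move=> d0; rewrite /layer;
  case: (clamp_cases (u x - k%:R * d) (ltW d0)) => [[? ->]|[? ? ->]|[? ->]]; lra.
Qed.

Lemma clamp0 a : clamp a 0 = 0.
Proof. by rewrite /clamp; case: (leP a 0) => [|?]; rewrite ?minxx// min_r// ltW. Qed.

Lemma sum_layer d N u x : 0 < d -> \sum_(k < N) layer d k u x = clamp (u x) (N%:R * d).
Proof.
move=> d0; under eq_bigr do rewrite layerE//.
by rewrite -(big_mkord xpredT (fun k => clamp (u x) (k.+1%:R * d) - clamp (u x) (k%:R * d)))
  telescope_sumr// mul0r clamp0 subr0.
Qed.

Lemma layer_half d k u x : 0 < d ->
  layer d k u x = layer (d / 2) k.*2 u x + layer (d / 2) k.*2.+1 u x.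
Proof.
move=> d0; have d20 : 0 < d / 2 by lra.
rewrite !layerE//.
have -> : k.*2.+2%:R * (d / 2) = k.+1%:R * d by rewrite -doubleS -mul2n natrM; field.
have -> : k.*2%:R * (d / 2) = k%:R * d by rewrite -mul2n natrM; field.
ring.
Qed.

Lemma sum_ord_double (N : nat) (G : nat -> R) :
  \sum_(j < N.*2) G j = \sum_(k < N) (G k.*2 + G k.*2.+1).
Proof.
elim: N => [|N IH]; first by rewrite !big_ord0.
by rewrite doubleS !big_ord_recr/= IH addrA.
Qed.

(* Piecewise linear interpolation of a |-> a^2 at the nodes k / 2^n. *)
Definition interp_sqr (n : nat) u (x : X) : R :=
  \sum_(k < 2 ^ n) (k.*2.+1%:R * (2^-1) ^+ n) * layer ((2^-1) ^+ n) k u x.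

(** On each slice the exact chord slope c (k+1) + c k differs from (2k+1) d by at most d wherever
    the slice is nonzero. The factor [|u x|] makes the error square integrable even when m is
    infinite. *)
Lemma interp_sqr_err n u x : 0 <= u x <= 1 ->
  `|interp_sqr n u x - u x ^+ 2| <= (2^-1) ^+ n * `|u x|.
Proof.
move=> /andP[u0 u1]; set d := (2^-1) ^+ n.
have d0 : 0 < d by rewrite exprn_gt0// invr_gt0.
have Nd : (2 ^ n)%:R * d = 1 :> R by rewrite natrX /d -exprMn divff ?expr1n.
have clampu : clamp (u x) ((2 ^ n)%:R * d) = u x.
  by rewrite Nd /clamp max_l// min_l.
pose c k := clamp (u x) (k%:R * d).
have usq : u x ^+ 2 = \sum_(k < 2 ^ n) layer d k u x * (c k.+1 + c k).
  rewrite (eq_bigr (fun k : 'I_(2 ^ n) => c k.+1 ^+ 2 - c k ^+ 2)); last first.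
    by move=> k _; rewrite layerE// subr_sqr.
  rewrite -(big_mkord xpredT (fun k => c k.+1 ^+ 2 - c k ^+ 2)) telescope_sumr//.
  by rewrite /c clampu mul0r clamp0 expr0n subr0.
rewrite usq /interp_sqr -sumrB; apply: le_trans (ler_norm_sum _ _ _) _.
rewrite (ger0_norm u0) -[X in _ <= _ * X]clampu -sum_layer// mulr_sumr.
apply: ler_sum => k _; set l := layer d k u x.
rewrite (mulrC l) -mulrBl normrM (ger0_norm (layer_ge0 k u x d0)) -/d -/l.
have k0 : 0 <= k%:R * d by rewrite mulr_ge0// ltW.
have k1 : k.+1%:R * d = k%:R * d + d by rewrite -natr1 mulrDl mul1r.
have k10 : 0 <= k.+1%:R * d by rewrite mulr_ge0// ltW.
have k2 : k.*2.+1%:R * d = 2 * (k%:R * d) + d.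
  by rewrite -natr1 -mul2n natrM; ring.
have l0 : 0 <= l by exact: layer_ge0.
have [->|ln0] := eqVneq l 0; first by rewrite !mulr0.
rewrite ler_wpM2r// k2 /c.
move: ln0; rewrite /l layerE//.
case: (clamp_cases (u x) k0) => [[? ->]|[? ? ->]|[? ->]];
  case: (clamp_cases (u x) k10) => [[? ->]|[? ? ->]|[? ->]] => /eqP ?;
  rewrite ler_norml; apply/andP; split; lra.
Qed.

(** After halving the slices, old and new slopes differ by plus or minus half the old mesh. These
    uniformly small slopes make the energies of the differences decay like 4^-n. *)
Lemma interp_sqr_step n u x : interp_sqr n u x - interp_sqr n.+1 u x =
  \sum_(j < 2 ^ n.+1) ((-1) ^+ j * (2^-1) ^+ n.+1) * layer ((2^-1) ^+ n.+1) j u x.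
Proof.
pose d : R := (2^-1) ^+ n.
have d0 : 0 < d by rewrite exprn_gt0// invr_gt0.
have dS : (2^-1) ^+ n.+1 = d / 2 by rewrite exprS mulrC.
rewrite /interp_sqr dS -/d expnS mul2n.
rewrite (sum_ord_double _ (fun j => j.*2.+1%:R * (d / 2) * layer (d / 2) j u x)).
rewrite (sum_ord_double _ (fun j => (-1) ^+ j * (d / 2) * layer (d / 2) j u x)).
rewrite -sumrB; apply: eq_bigr => k _.
have sgn : (-1) ^+ k.*2 = 1 :> R by rewrite -mul2n exprM sqrrN !expr1n.
rewrite layer_half// exprS sgn.
rewrite doubleS -!(natr1 k.*2) -!(natr1 k.*2.*2.+2) -!(natr1 k.*2.*2.+1) -!(natr1 k.*2.*2).
by rewrite -!mul2n !natrM; field.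
Qed.

End layers.

(** * From slices to products of bounded functions *)

Section form_products.
Context (R : realType) (X : ptopologicalType).
Local Notation T := (borel X).
Context (m : {measure set T -> \bar R}) (E : (X -> R) -> (X -> R) -> R).
Context (F : set (X -> R)) (hF : dirichlet_form m E F).
Implicit Types f g h u : X -> R.

Lemma form_clamp u (c : R) : F u -> 0 <= c -> F (fun x => clamp (u x) c).
Proof.
move=> Fu; rewrite le0r => /orP[/eqP->|c0]; last by have [] := form_cut hF Fu c0.
rewrite (_ : (fun _ => _) = (fun=> 0)); first exact: form0 hF.
by apply/funext => x; rewrite clamp0.
Qed.

Lemma form_layer u (d : R) k : F u -> 0 < d -> F (layer d k u).
Proof.
move=> Fu d0; rewrite (_ : layer d k u = (fun x => clamp (u x) (k.+1%:R * d)) \-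
  (fun x => clamp (u x) (k%:R * d))).
  by apply: (formB hF); apply: form_clamp => //; rewrite mulr_ge0// ltW.
by apply/funext => x; rewrite layerE.
Qed.

(** For j < k, the slice j is already full wherever the slice k is positive, so cutting l_j + s l_k
    to [0, d] gives back l_j. Contraction yields 0 <= 2 s E(l_j, l_k) + s^2 E(l_k, l_k); divide by s
    and take s small. *)
Lemma form_layer_ge0 u (d : R) j k : F u -> 0 < d -> 0 <= E (layer d j u) (layer d k u).
Proof.
move=> Fu d0; have Fl i := form_layer i Fu d0.
wlog jk : j k / (j <= k)%N => [H|].
  have [jk|/ltnW kj] := leqP j k; first exact: H.
  by rewrite (formC hF)//; exact: H.
move: jk; rewrite leq_eqVlt => /orP[/eqP->|jk]; first exact: (form_ge0 hF (Fl k)).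
have key s : 0 < s -> 0 <= 2 * E (layer d j u) (layer d k u) + s * E (layer d k u) (layer d k u).
  move=> s0; have Fsl := formZ hF s (Fl k).
  have [_] := form_cut hF (formD hF (Fl j) Fsl) d0.
  set g := (fun _ => _); have -> : g = layer d j u.
    apply/funext => x; rewrite /g -/(clamp _ _) /=.
    have jkd : j.+1%:R * d <= k%:R * d by rewrite ler_pM2r// ler_nat.
    have l0 := layer_ge0 k u x d0.
    rewrite -natr1 mulrDl mul1r in jkd.
    move: l0; rewrite /layer.
    case: (clamp_cases (u x - k%:R * d) (ltW d0)) => [[? ->]|[? ? ->]|[? ->]] l0;
    have sl0 := mulr_ge0 (ltW s0) l0;
    case: (clamp_cases (u x - j%:R * d) (ltW d0)) => [[? ->]|[? ? ->]|[? ->]];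
    match goal with |- clamp ?A _ = _ =>
      case: (clamp_cases A (ltW d0)) => [[? ->]|[? ? ->]|[? ->]] end; try lra;
    rewrite ?mulr0 in sl0 *; lra.
  rewrite (formDD hF)// (formZr hF)// (formZl hF)// (formZr hF)//.
  by move=> le; rewrite -(pmulr_rge0 _ s0); nra.
rewrite leNgt; apply/negP => neg.
have Ek := form_ge0 hF (Fl k).
set e := E _ (layer d k u) in neg key.
(* With e < 0 and b the energy of the slice k, this s turns 2 e + s b into e (2 - b / (b + 1)) < 0;
   adding 1 avoids division by zero. *)
have := key (- e / (E (layer d k u) (layer d k u) + 1)).
have p0 : 0 < E (layer d k u) (layer d k u) + 1 by lra.
rewrite divr_gt0 ?oppr_gt0// => /(_ isT).
set b := E (layer d k u) (layer d k u) in p0 *.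
have : b / (b + 1) <= 1 by rewrite ler_pdivrMr// mul1r; lra.
rewrite -mulrA (mulrC _ b) => b1; nra.
Qed.

(* All the layer energies are nonnegative, so replacing every slope by L only
   increases the energy: this is the contraction property for piecewise linear
   functions. *)
Lemma form_piecewise_linear_le u (d L : R) N (s : nat -> R) : F u -> 0 < d ->
  (0 < N)%N ->
  (forall k, `|s k| <= L) ->
  let v := fun x => \sum_(k < N) s k * layer d k u x in
  F v /\ E v v <= L ^+ 2 * E u u.
Proof.
move=> Fu d0 N0 sL v; have Fl i := form_layer i Fu d0.
have Fv (s' : nat -> R) : F (fun x => \sum_(k < N) s' k * layer d k u x).
  exact: (@form_sum _ _ _ _ _ hF N (fun k => layer d k u) s' Fl).
have EE (s' : nat -> R) : E (fun x => \sum_(k < N) s' k * layer d k u x)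
    (fun x => \sum_(k < N) s' k * layer d k u x) =
    \sum_(j < N) \sum_(k < N) s' j * s' k * E (layer d j u) (layer d k u).
  rewrite (@form_suml _ _ _ _ _ hF N (fun k => layer d k u) s')//; apply: eq_bigr => j _.
  rewrite (formC hF)// (@form_suml _ _ _ _ _ hF N (fun k => layer d k u) s')// mulr_sumr; apply: eq_bigr => k _.
  by rewrite (formC hF (Fl k))// mulrA.
split; first exact: Fv.
have L0 : 0 <= L by apply: le_trans (sL 0%N).
apply: (@le_trans _ _ (L ^+ 2 * \sum_(j < N) \sum_(k < N) 1 * 1 * E (layer d j u) (layer d k u))).
  rewrite EE mulr_sumr; apply: ler_sum => j _; rewrite mulr_sumr; apply: ler_sum => k _.
  rewrite !mul1r ler_wpM2r//; first exact: form_layer_ge0.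
  by apply: le_trans (ler_norm _) _; rewrite normrM expr2 ler_pM.
rewrite -(EE (fun=> 1)) ler_wpM2l ?sqr_ge0//.
have Nd : 0 < N%:R * d by rewrite mulr_gt0// ltr0n.
have [_] := form_cut hF Fu Nd.
rewrite (_ : (fun x => \sum_(k < N) 1 * layer d k u x) = (fun x => clamp (u x) (N%:R * d)))//.
by apply/funext => x; under eq_bigr do rewrite mul1r; rewrite sum_layer.
Qed.

(** The interpolants of u^2 converge geometrically in E1, at the ratio 1/4 that [E1_geometric_limit]
    asks for. Their limit lies in F and agrees m-a.e. with u^2, because they also converge to u^2 in
    L^2. *)
Lemma form_sqr01 u : F u -> (forall x, 0 <= u x <= 1) -> F (u \* u).
Proof.
move=> Fu u01; pose dl n : R := (2^-1) ^+ n.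
have dl0 n : 0 < dl n by rewrite exprn_gt0// invr_gt0.
have usq : sqint m u by exact: form_sqint hF _ Fu.
have mu2 : measurable_fun [set: T] ((u \* u : X -> R) : T -> R).
  by apply: measurable_funM; case: usq.
have Fi n : F (interp_sqr n u).
  apply: (@form_sum _ _ _ _ _ hF _ (fun k => layer (dl n) k u)
    (fun k => k.*2.+1%:R * dl n)) => k.
  exact: form_layer.
have err n : sqint m (interp_sqr n u \- u \* u) /\
    L2sq m (interp_sqr n u \- u \* u) <= dl n ^+ 2 * L2sq m u.
  apply: sqint_le => //; first exact: ltW.
    by apply: measurable_funB => //; have [] := form_sqint hF (Fi n).
  by move=> x; exact: interp_sqr_err.
have step n : E1 m E (interp_sqr n u \- interp_sqr n.+1 u) <= 4 * E1 m E u * (4^-1) ^+ n.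
  have eqs : interp_sqr n u \- interp_sqr n.+1 u = (fun x => \sum_(j < 2 ^ n.+1)
      ((-1) ^+ j * dl n.+1) * layer (dl n.+1) j u x).
    by apply/funext => x; exact: interp_sqr_step.
  have [|k|_ Ele] := @form_piecewise_linear_le u (dl n.+1) (dl n.+1) (2 ^ n.+1)
      (fun j => (-1) ^+ j * dl n.+1) Fu (dl0 _) _ _.
  - by rewrite expn_gt0.
  - by rewrite normrM normrX normrN1 expr1n mul1r ger0_norm// ltW.
  have Lle : L2sq m (interp_sqr n u \- interp_sqr n.+1 u) <= 4 * dl n ^+ 2 * L2sq m u.
    have [s1 e1] := err n; have [s2 e2] := err n.+1.
    have [s3 e3] := sqintZ (-1) s2.
    have [_ e4] := sqintD s1 s3.
    rewrite (_ : _ \- interp_sqr n.+1 u = (interp_sqr n u \- u \* u) \+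
      (fun x => -1 * (interp_sqr n.+1 u \- u \* u) x)); last first.
      by apply/funext => x /=; ring.
    apply: le_trans e4 _; rewrite e3 sqrrN expr1n mul1r.
    have : dl n.+1 ^+ 2 * L2sq m u <= dl n ^+ 2 * L2sq m u.
      rewrite ler_wpM2r ?L2sq_ge0// lerXn2r ?nnegrE ?(ltW (dl0 _))//.
      by rewrite /dl exprS ler_piMl// ?(ltW (dl0 n))//; lra.
    lra.
  have d4 : dl n ^+ 2 = (4^-1) ^+ n.
    by rewrite /dl -exprM mulnC exprM; congr (_ ^+ _); field.
  have d4S : dl n.+1 ^+ 2 = (4^-1) * (4^-1) ^+ n.
    by rewrite -d4 /dl (exprS _ n) exprMn; congr (_ * _); field.
  rewrite d4 in Lle; rewrite d4S in Ele.
  have E0 := form_ge0 hF Fu; have p0 : 0 <= (4^-1) ^+ n :> R by rewrite exprn_ge0.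
  have pE := mulr_ge0 p0 E0.
  rewrite /E1 {1 2}eqs; move: Ele Lle; rewrite -!eqs; nra.
have [|v Fv [cv _]] := E1_geometric_limit hF Fi step.
  by move=> k; rewrite exprS; lra.
have vs := form_sqint hF Fv.
have Fvi n := formB hF (Fi n) Fv.
have vuE n : v \- u \* u = (fun x => -1 * (interp_sqr n u \- v) x) \+ (interp_sqr n u \- u \* u).
  by apply/funext => x /=; ring.
have vle n : sqint m (v \- u \* u) /\ L2sq m (v \- u \* u) <=
    2 * E1 m E (interp_sqr n u \- v) + 2 * (2^-1) ^+ n * L2sq m u.
  have [s1 e1] := err n; have [s2 e2] := sqintZ (-1) (form_sqint hF (Fvi n)).
  have [s3] := sqintD s2 s1; rewrite -vuE => le.
  split; first by rewrite (vuE n).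
  rewrite e2 sqrrN expr1n mul1r in le.
  apply: le_trans le _; rewrite /E1.
  have := form_ge0 hF (Fvi n).
  have : dl n ^+ 2 * L2sq m u <= (2^-1) ^+ n * L2sq m u.
    rewrite ler_wpM2r ?L2sq_ge0// expr2 ler_piMl ?(ltW (dl0 n))// /dl.
    by rewrite exprn_ile1//; lra.
  lra.
have v0 : L2sq m (v \- u \* u) = 0.
  apply/eqP; rewrite eq_le L2sq_ge0 andbT.
  have cvr : 2 * E1 m E (interp_sqr n u \- v) + 2 * (2^-1) ^+ n * L2sq m u @[n --> \oo] --> (0 : R).
    rewrite -[X in _ --> X](addr0 (0 : R)) -{1}(mulr0 2) -[X in _ + X](mul0r (L2sq m u)).
    apply: cvgD; first exact: cvgMr.
    apply: cvgMl; rewrite -[X in _ --> X](mulr0 2); apply: cvgMr.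
    by apply: cvg_expr; rewrite ger0_norm; lra.
  have <- := cvg_lim (@Rhausdorff R) cvr.
  apply: limr_ge; first by apply/cvg_ex; exists 0.
  by apply: nearW => n; have [] := vle n.
apply: (form_ae hF Fv) => //.
have := L2sq_eq0 (vle 0%N).1 v0; apply: filterS => x /= /eqP.
by rewrite subr_eq0 => /eqP.
Qed.

Definition bounded_by f (M : R) := forall x, `|f x| <= M.

(** f^2 is the sum of the squares of the positive and negative parts, and each part divided by M
    takes values in [0, 1]. *)
Lemma form_sqr f (M : R) : F f -> bounded_by f M -> F (f \* f).
Proof.
move=> Ff fM; wlog M0 : M fM / 0 < M => [H|].
  apply: (H (M + 1)); last by have := le_trans (normr_ge0 _) (fM point); lra.
  by move=> x; have := fM x; lra.
have pos g : F g -> bounded_by g M -> F (fun x => Num.max (g x) 0 * Num.max (g x) 0).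
  move=> Fg gM; pose v x := M^-1 * clamp (g x) M.
  have vE x : clamp (g x) M = Num.max (g x) 0.
    rewrite /clamp min_l// ge_max (ltW M0) andbT.
    by apply: le_trans (ler_norm _) (gM x).
  have Fv : F v by apply: (formZ hF); apply: form_clamp => //; exact: ltW.
  have v01 x : 0 <= v x <= 1.
    rewrite /v; case: (clamp_cases (g x) (ltW M0)) => [[? ->]|[? ? ->]|[? ->]].
    - by rewrite mulr0 lexx ler01.
    - by rewrite mulr_ge0 ?invr_ge0 ?(ltW M0)//= mulrC ler_pdivrMr// mul1r.
    - by rewrite mulVf ?gt_eqF// ler01 lexx.
  rewrite (_ : (fun _ => _) = (fun x => M ^+ 2 * (v \* v) x)).
    by apply: (formZ hF); exact: form_sqr01.
  by apply/funext => x; rewrite /v/= vE; field; rewrite gt_eqF.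
have p1 := pos f Ff fM.
have := pos (fun x => -1 * f x) (formZ hF _ Ff).
have fM' : bounded_by (fun x => -1 * f x) M.
  by move=> x; rewrite mulN1r normrN.
move=> /(_ fM') p2; have := formD hF p1 p2.
rewrite (_ : _ \+ _ = f \* f)//; apply/funext => x /=; rewrite mulN1r.
by case: (leP (f x) 0) => ?; case: (leP (- f x) 0) => ?; nra.
Qed.

Lemma form_mul f g (M N : R) : F f -> F g -> bounded_by f M -> bounded_by g N ->
  F (f \* g).
Proof.
move=> Ff Fg fM gN.
have fg : bounded_by (f \+ g) (M + N).
  by move=> x; apply: le_trans (ler_normD _ _) _; exact: lerD.
have s1 := form_sqr (formD hF Ff Fg) fg.
have s2 := formB hF (formB hF s1 (form_sqr Ff fM)) (form_sqr Fg gN).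
have := formZ hF 2^-1 s2; rewrite (_ : (fun _ => _) = f \* g)//.
by apply/funext => x /=; field.
Qed.

End form_products.

(** * Combinations of finite Borel measures are determined by test functions *)

Lemma cvg_sum_seq (R : realType) (J : Type) (r : seq J) (f : J -> nat -> R) (l : J -> R) :
  (forall i, f i n @[n --> \oo] --> l i) ->
  \sum_(i <- r) f i n @[n --> \oo] --> \sum_(i <- r) l i.
Proof.
move=> fl; elim: r => [|i r IH].
  by rewrite big_nil; under eq_fun do rewrite big_nil; exact: cvg_cst.
by rewrite big_cons; under eq_fun do rewrite big_cons; exact: cvgD.
Qed.

Section borel_cc.
Context (R : realType) (X : ptopologicalType).
Local Notation T := (borel X).

Lemma open_borel (U : set X) : open U -> measurable (U : set T).
Proof. by move=> oU; exact: sub_sigma_algebra. Qed.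

Lemma continuous_borel (f : X -> R) : continuous f -> measurable_fun [set: T] (f : T -> R).
Proof.
move=> /continuousP cf; apply: (measurability _ (RGenOpens.measurableE R)) => //.
move=> _ [_ [a [b ->] <-]]; rewrite setTI.
by apply: open_borel; apply: cf; exact: interval_open.
Qed.

Lemma Cc_bounded (f : X -> R) : Cc f -> exists M, bounded_by f M.
Proof.
move=> [cf Kf].
have /compact_bounded[M [_ HM]] : compact (f @` closure [set x | f x != 0]).
  by apply: continuous_compact => //; exact: continuous_subspaceT.
exists (Num.max (M + 1) 0) => x; have [->|fx] := eqVneq (f x) 0.
  by rewrite normr0 le_max lexx orbT.
rewrite le_max; apply/orP; left; apply: (HM (M + 1)) => //; first by rewrite ltrDl.
by exists x => //; apply: subset_closure.
Qed.

Lemma bounded_integrable (mu : {measure set T -> \bar R}) (f : X -> R) M :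
  (mu setT < +oo)%E -> measurable_fun [set: T] (f : T -> R) -> bounded_by f M ->
  mu.-integrable [set: T] (fun x => (f x)%:E).
Proof.
move=> fin mf fM; apply: measurable_bounded_integrable => //.
by exists M; split; rewrite ?num_real// => N MN x _; apply: le_trans (fM x) (ltW MN).
Qed.

Definition relcompact_open (U : set X) := open U /\ compact (closure U).

Lemma relcompact_open_sub (U V : set X) : open U -> U `<=` V -> compact (closure V) ->
  relcompact_open U.
Proof.
move=> oU UV cV; split=> //; apply: subclosed_compact cV _; first exact: closed_closure.
exact: closureS.
Qed.

Lemma relcompact_openI : setI_closed relcompact_open.
Proof.
move=> U V [oU cU] [oV cV]; apply: (@relcompact_open_sub _ U) => //.
exact: openI.
Qed.

(** * Approximating indicators of open sets by compactly supported functions *)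

Context (dist : X -> X -> R) (dist_ge0 : forall x y, 0 <= dist x y)
  (dist_eq0 : forall x y, dist x y = 0 <-> x = y)
  (dist_sym : forall x y, dist x y = dist y x)
  (dist_tri : forall x y z, dist x z <= dist x y + dist y z)
  (dist_open : forall U : set X, open U <->
     (forall x, U x -> exists2 r : R, 0 < r & [set y | dist x y < r] `<=` U)).

Let dball x r := [set y | dist x y < r].

Lemma distxx x : dist x x = 0.
Proof. by apply/dist_eq0. Qed.

Lemma open_dball x r : open (dball x r).
Proof.
apply/dist_open => y; rewrite /dball/= => xy; exists (r - dist x y) => /=; first lra.
by move=> z /= yz; have := dist_tri x y z; lra.
Qed.

Lemma nbhs_dball x r : 0 < r -> nbhs x (dball x r).
Proof. by move=> r0; apply: open_nbhs_nbhs; split; [exact: open_dball|rewrite /dball/= distxx]. Qed.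

(** The distance to the complement of U, truncated at 1. Stated through balls inside U, it is
    meaningful for the whole space too. *)
Definition inner_radius (U : set X) (x : X) : R :=
  sup [set r | 0 <= r <= 1 /\ dball x r `<=` U].

Let has_sup_inner U x : has_sup [set r | 0 <= r <= 1 /\ dball x r `<=` U].
Proof.
split; last by exists 1 => r /= [/andP[]].
by exists 0; split=> /=; [rewrite lexx ler01|move=> y /=; rewrite /dball/= ltNge dist_ge0].
Qed.

Lemma inner_radius_ge U x r : 0 <= r <= 1 -> dball x r `<=` U -> r <= inner_radius U x.
Proof. by move=> r01 rU; apply: ub_le_sup; [case: (has_sup_inner U x)|split]. Qed.

Lemma inner_radius_ge0 U x : 0 <= inner_radius U x.
Proof.
apply: inner_radius_ge; first by rewrite lexx ler01.
by move=> y; rewrite /dball/= ltNge dist_ge0.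
Qed.

Lemma inner_radius_out U x : ~ U x -> inner_radius U x = 0.
Proof.
move=> nUx; apply/eqP; rewrite eq_le inner_radius_ge0 andbT.
apply: ge_sup; first by case: (has_sup_inner U x).
move=> r /= [_ rU]; rewrite leNgt; apply/negP => r0; apply/nUx/rU.
by rewrite /dball/= distxx.
Qed.

Lemma inner_radius_gt0 U x : open U -> U x -> 0 < inner_radius U x.
Proof.
move=> /dist_open oU /oU[r r0 rU].
apply: (@lt_le_trans _ _ (Num.min r 1)); first by rewrite lt_min r0 ltr01.
apply: inner_radius_ge; first by rewrite le_min ltW//= ler01 ge_min lexx orbT.
by move=> y; rewrite /dball/= lt_min => /andP[yr _]; exact: rU.
Qed.

Lemma inner_radius_lip U x y : inner_radius U x - dist x y <= inner_radius U y.
Proof.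
rewrite lerBlDr; apply: ge_sup; first by case: (has_sup_inner U x).
move=> r /= [/andP[r0 r1] rU]; rewrite -lerBlDr.
have [rd|rd] := leP r (dist x y).
  by apply: le_trans (inner_radius_ge0 U y); lra.
apply: inner_radius_ge; first by have := dist_ge0 x y; lra.
by move=> z; rewrite /dball/= => yz; apply: rU; rewrite /dball/=; have := dist_tri x y z; lra.
Qed.

Lemma continuous_inner_radius U : continuous (inner_radius U).
Proof.
move=> x; apply/cvgrPdist_lt => e e0.
have := nbhs_dball x e0; apply: filterS => y; rewrite /dball/= => xy.
have := inner_radius_lip U x y; have := inner_radius_lip U y x; rewrite (dist_sym y x).
by rewrite ltr_norml => *; apply/andP; split; lra.
Qed.

Definition inner_bump (U : set X) (n : nat) (x : X) : R :=
  Num.min 1 (n%:R * inner_radius U x).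

Lemma inner_bump01 U n x : 0 <= inner_bump U n x <= 1.
Proof.
rewrite /inner_bump le_min ler01/= ge_min lexx/= andbT.
by rewrite mulr_ge0// inner_radius_ge0.
Qed.

Lemma Cc_inner_bump U n : relcompact_open U -> Cc (inner_bump U n).
Proof.
move=> [oU cU]; split.
  move=> x; apply: (@continuous_min _ _ (cst 1) (fun y => n%:R * inner_radius U y)).
    exact: cvg_cst.
  by apply: cvgMr; exact: continuous_inner_radius.
apply: subclosed_compact cU _; first exact: closed_closure.
apply: closureS => x /=; apply: contraPP => nUx.
by rewrite /inner_bump inner_radius_out// mulr0 min_r// eqxx.
Qed.

Lemma inner_bump_cvg U x : open U -> inner_bump U n x @[n --> \oo] --> (\1_U x : R).
Proof.
move=> oU; rewrite indicE; have [Ux|nUx] := pselect (U x); last first.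
  rewrite memNset//=; apply: (@cvg_trans _ (@cst nat R 0 @ \oo)); last exact: cvg_cst.
  apply: near_eq_cvg; near=> n; rewrite /= /inner_bump inner_radius_out//.
  by rewrite mulr0 min_r.
rewrite mem_set//=; apply: (@cvg_trans _ (@cst nat R 1 @ \oo)); last exact: cvg_cst.
apply: near_eq_cvg; near=> n; rewrite /= /inner_bump min_l//.
have i0 := inner_radius_gt0 oU Ux.
rewrite -ler_pdivrMr// mul1r; near: n; exact: nbhs_infty_ger.
Unshelve. all: by end_near.
Qed.

Context (lc : locally_compact [set: X]) (sep : separable_space X).

Lemma open_relcompact_cover (V : set X) : open V ->
  exists W : nat -> set X, (forall k, relcompact_open (W k)) /\ V = \bigcup_k W k.
Proof.
move=> oV; case: sep => D [/countable_injP[c cinj] clD].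
(* [e] inverts the injection [c] on D. Indices outside the image of D yield the default [point],
   which is harmless because only suitable balls are kept below. *)
pose e k := xget point [set x | D x /\ c x = k].
have eD x : D x -> e (c x) = x.
  move=> Dx; rewrite /e; case: xgetP => [y _ [Dy cyx]|/(_ x)]; last by case.
  by apply: cinj; rewrite ?inE.
pose B k j := dball (e k) j.+1%:R^-1.
pose P (kj : nat * nat) := relcompact_open (B kj.1 kj.2) /\ B kj.1 kj.2 `<=` V.
(* One index codes a center and a radius; a ball that is not relatively compact or not inside V is
   replaced by the empty set. *)
pose W n := if unpickle n is Some kj then
  if `[< P kj >] then B kj.1 kj.2 else set0 else set0.
have rc0 : relcompact_open set0 by split; [exact: open0|rewrite closure0; exact: compact0].
exists W; split.
  move=> n; rewrite /W; case: unpickle => [kj|//]; case: asboolP => [[]|]//.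
apply/seteqP; split => [x Vx|x [n _]]; last first.
  by rewrite /W; case: unpickle => [kj|//]; case: asboolP => [[_ sub]|//]; exact: sub.
have [K nK [cK clK]] := lc (I : [set: X] x).
have {}nK : nbhs x K.
  by move: nK; rewrite /within/=; apply: filterS => y; apply.
have : nbhs x (V `&` K) by apply: filterI => //; exact: open_nbhs_nbhs.
rewrite nbhsE; move=> [Q [oQ Qx] QVK].
have [r r0 rO] := (dist_open Q).1 oQ x Qx.
have r20 : 0 < r / 2 by lra.
have [j jr] : exists j : nat, j.+1%:R^-1 < r / 2.
  have /cvgrPdist_lt/(_ _ r20)[j _ /(_ j (leqnn j))] := @cvg_harmonic R.
  by rewrite /= sub0r normrN ger0_norm ?invr_ge0//; exists j.
have j0 : 0 < j.+1%:R^-1 :> R by rewrite invr_gt0.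
have [d [Dd xd]] : exists d, D d /\ dist x d < j.+1%:R^-1.
  have : closure D x by rewrite clD.
  by move=> /(_ _ (nbhs_dball x j0)) [d []]; exists d.
have BO : B (c d) j `<=` Q.
  move=> y; rewrite /B eD// /dball/= => dy; apply: rO => /=.
  apply: le_lt_trans (dist_tri x d y) _; rewrite [r]splitr.
  by apply: ltrD; apply: lt_trans jr.
have PB : P (c d, j).
  split; last by move=> y /BO /QVK[].
  apply: (@relcompact_open_sub _ K); first exact: open_dball.
    by move=> y /BO /QVK[].
  by move/closure_id: clK => <-.
exists (pickle (c d, j)) => //; rewrite /W pickleK; case: asboolP => //= _.
by rewrite /B eD// /dball/= dist_sym.
Qed.

Lemma borel_relcompactE : @measurable _ T = <<s relcompact_open >>.
Proof.
apply/seteqP; split; apply: smallest_sub; try exact: smallest_sigma_algebra.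
- move=> V oV; have [W [rW ->]] := open_relcompact_cover oV.
  by apply: sigma_algebra_bigcup => k; exact: sub_sigma_algebra.
- by move=> U [oU _]; exact: sub_sigma_algebra.
Qed.

Context (J : Type) (s : seq J) (c : J -> R) (mu : J -> {measure set T -> \bar R}).
Context (fin : forall i, (mu i setT < +oo)%E).
Context (Phi : set (X -> R)) (PhiCc : forall phi, Phi phi -> Cc phi).
Context (Phi_dense : forall psi, Cc psi -> forall e : R, 0 < e ->
  exists2 phi, Phi phi & forall x, `|phi x - psi x| < e).

Let fin_num A i : measurable A -> mu i A \is a fin_num.
Proof.
move=> mA; rewrite ge0_fin_numE//; apply: le_lt_trans (fin i).
by apply: le_measure; rewrite ?inE.
Qed.

(** All measures are finite, so each integral is continuous for uniform convergence, and [Phi] is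
    uniformly dense. *)
Lemma comb_integral_Cc :
  (forall phi, Phi phi -> \sum_(i <- s) c i * fine (\int[mu i]_x (phi x)%:E) = 0) ->
  forall psi, Cc psi -> \sum_(i <- s) c i * fine (\int[mu i]_x (psi x)%:E) = 0.
Proof.
move=> H psi Cpsi; pose K := \sum_(i <- s) `|c i| * fine (mu i setT).
have K0 : 0 <= K.
  by apply: sumr_ge0 => i _; rewrite mulr_ge0// fine_ge0.
apply/eqP; rewrite -normr_le0; apply/ler_addgt0Pr => e e0; rewrite add0r.
(* K is the total mass weighted by [|c i|]; it may vanish, whence K + 1. *)
have e1 : 0 < e / (K + 1) by rewrite divr_gt0//; lra.
have [phi Pphi phipsi] := Phi_dense Cpsi e1.
have Cphi := PhiCc Pphi.
have [M1 psiM] := Cc_bounded Cpsi; have [M2 phiM] := Cc_bounded Cphi.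
have mpsi := continuous_borel Cpsi.1; have mphi := continuous_borel Cphi.1.
have -> : \sum_(i <- s) c i * fine (\int[mu i]_x (psi x)%:E) =
    \sum_(i <- s) (c i * fine (\int[mu i]_x (psi x)%:E) - c i * fine (\int[mu i]_x (phi x)%:E)).
  by rewrite sumrB (H _ Pphi) subr0.
apply: (@le_trans _ _ (\sum_(i <- s) e / (K + 1) * (`|c i| * fine (mu i setT)))).
  apply: le_trans (ler_norm_sum _ _ _) _; apply: ler_sum => i _.
  rewrite -mulrBr normrM mulrCA ler_wpM2l//.
  have i1 := bounded_integrable (fin i) mpsi psiM.
  have i2 := bounded_integrable (fin i) mphi phiM.
  rewrite -[X in _ <= X](@Rintegral_cst _ _ _ (mu i) setT measurableT).
  have -> : fine (\int[mu i]_x (psi x)%:E) - fine (\int[mu i]_x (phi x)%:E) =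
     \int[mu i]_x (psi x - phi x) by rewrite (@RintegralB _ _ _ (mu i))//.
  have i3 : (mu i).-integrable [set: T] (fun x => (psi x - phi x)%:E).
    by have := integrableB measurableT i1 i2; apply: eq_integrable.
  apply: le_trans; first exact: le_normr_Rintegral.
  apply: le_Rintegral => //.
  - by have := integrable_abse i3; apply: eq_integrable.
  - by apply: (@bounded_integrable _ (cst (e / (K + 1))) (e / (K + 1))) => //;
      move=> x; rewrite ger0_norm// ltW.
  - by move=> x _; rewrite distrC ltW.
by rewrite -mulr_sumr -/K mulrAC ler_pdivrMr ?ltr_wpDl//; nra.
Qed.

Lemma comb_measure_cvg (A : nat -> set T) (B : set T) :
  (forall n, measurable (A n)) -> measurable B ->
  (forall i, mu i (A n) @[n --> \oo] --> mu i B) ->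
  (forall n, \sum_(i <- s) c i * fine (mu i (A n)) = 0) ->
  \sum_(i <- s) c i * fine (mu i B) = 0.
Proof.
move=> mA mB AB A0.
have : \sum_(i <- s) c i * fine (mu i (A n)) @[n --> \oo] -->
    \sum_(i <- s) c i * fine (mu i B).
  apply: cvg_sum_seq => i; apply: cvgMr; apply: fine_cvg.
  by rewrite fineK; [exact: AB|exact: fin_num].
under eq_fun do rewrite A0.
by move/(cvg_lim (@Rhausdorff R)) => <-; rewrite lim_cst.
Qed.

(** Bumps reach the indicators of relatively compact open sets, a pi-system generating the Borel
    sets, and the pi-lambda theorem does the rest. Working with sums of real values avoids signed
    measures. *)
Lemma comb_measure_unique :
  (forall phi, Phi phi -> \sum_(i <- s) c i * fine (\int[mu i]_x (phi x)%:E) = 0) ->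
  forall A : set T, measurable A -> \sum_(i <- s) c i * fine (mu i A) = 0.
Proof.
move=> /comb_integral_Cc H A mA.
have GP : relcompact_open `<=` [set A | \sum_(i <- s) c i * fine (mu i A) = 0].
  move=> U rU /=; have [oU _] := rU; have mU := open_borel oU.
  have : \sum_(i <- s) c i * fine (\int[mu i]_x (inner_bump U n x)%:E) @[n --> \oo] -->
      \sum_(i <- s) c i * fine (mu i U).
    apply: cvg_sum_seq => i; apply: cvgMr; apply: fine_cvg; rewrite fineK ?fin_num//.
    rewrite -[X in _ --> mu i X]setIT -integral_indic//.
    have [//|||||_ _] := @dominated_convergence _ _ _ (mu i) setT measurableT
      (fun n x => (inner_bump U n x)%:E) (fun x => (\1_U x)%:E) (cst 1%E).
    - by move=> n; apply/measurable_EFinP; exact: continuous_borel (Cc_inner_bump n rU).1.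
    - by apply/measurable_EFinP; exact: measurable_indic.
    - apply: aeW => x _; apply: cvg_EFin; last exact: inner_bump_cvg.
      exact: nearW.
    - by apply: (@bounded_integrable _ (cst 1) 1) => // x; rewrite normr1.
    - apply: aeW => x n _; rewrite /= lee_fin.
      by have /andP[? ?] := inner_bump01 U n x; rewrite ger0_norm.
    by [].
  under eq_fun do rewrite H ?[Cc _](propT (Cc_inner_bump _ rU))//.
  by move/(cvg_lim (@Rhausdorff R)) => <-; rewrite lim_cst.
(* X itself need not be relatively compact, so it is exhausted by finite unions of such sets;
   stability under complement rests on this case. *)
have PT : \sum_(i <- s) c i * fine (mu i setT) = 0.
  have [W [rW WT]] := open_relcompact_cover (@openT X).
  apply: (@comb_measure_cvg (fun n => \big[setU/set0]_(k < n.+1) W k)) => //.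
  - by move=> n; apply: bigsetU_measurable => k _; apply: open_borel; case: (rW k).
  - move=> i; rewrite [X in mu i X]WT -(bigcup_bigsetU_bigcup W).
    apply: nondecreasing_cvg_mu.
    + by move=> n; apply: bigsetU_measurable => k _; apply: open_borel; case: (rW k).
    + rewrite bigcup_bigsetU_bigcup; apply: bigcup_measurable => k _.
      by apply: open_borel; case: (rW k).
    + move=> n k nk; apply/subsetPset; apply: subset_bigsetU; exact: nk.
  - move=> n; apply: GP; split.
      by apply: (big_ind (@open X)) => [|? ?|k _]; [exact: open0|exact: openU|case: (rW k)].
    elim: n.+1 => [|k IH]; first by rewrite big_ord0 closure0; exact: compact0.
    by rewrite big_ord_recr closureU; apply: compactU => //; case: (rW k).
apply: (@dynkin_induction _ T relcompact_open
  [set A | \sum_(i <- s) c i * fine (mu i A) = 0] borel_relcompactE) => //.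
- exact: relcompact_openI.
- move=> S mS /= S0; transitivity (\sum_(i <- s) (c i * fine (mu i setT) - c i * fine (mu i S))); last first.
    by rewrite sumrB PT S0 subrr.
  apply: eq_bigr => i _; rewrite -mulrBr; congr (_ * _).
  rewrite -setTD measureD//; last by rewrite fin.
  by rewrite setTI fineB ?fin_num.
- move=> G mG tG G0 /=.
  have mU n : measurable (\big[setU/set0]_(k < n) G k) by apply: bigsetU_measurable.
  apply: (@comb_measure_cvg (fun n => \big[setU/set0]_(k < n) G k)) => //.
  + exact: bigcup_measurable.
  + move=> i; have -> : (fun n => mu i (\big[setU/set0]_(k < n) G k)) =
        (fun n => \sum_(0 <= k < n) mu i (G k))%E.
      apply/funext => n; by rewrite measure_bigsetU// big_mkord.
    by apply: measure_semi_sigma_additive => //; exact: bigcup_measurable.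
  + elim=> [|n IH].
      by apply: big1 => i _; rewrite big_ord0 measure0 mulr0.
    transitivity (\sum_(i <- s) (c i * fine (mu i (\big[setU/set0]_(k < n) G k)) +
        c i * fine (mu i (G n)))); last by rewrite big_split/= IH (G0 n) addr0.
    apply: eq_bigr => i _; rewrite big_ord_recr/= measureU//; last 2 first.
    - exact: mU.
    - apply/seteqP; split=> // x [].
      rewrite -bigcup_mkord => -[k /= kn Gk] Gn.
      have := tG _ _ I I (ex_intro _ x (conj Gk Gn)) => kE.
      by rewrite kE ltnn in kn.
    by rewrite (fineD (fin_num i (mU n)) (fin_num i (mG n))) mulrDr.
- by rewrite -borel_relcompactE.
Qed.

End borel_cc.

(** * Energy measures are quadratic and continuous *)

Section energy_quadratic.
Context (R : realType) (X : ptopologicalType).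
Local Notation T := (borel X).
Context (m : {measure set T -> \bar R}) (E : (X -> R) -> (X -> R) -> R).
Context (F : set (X -> R)) (mu : (X -> R) -> {measure set T -> \bar R}).
Context (lc : locally_compact [set: X]) (sep : separable_space X) (met : metrizable R X).
Context (hF : dirichlet_form m E F) (hreg : regular_form m E F).
Context (hmu : energy_measures m E F mu).
Implicit Types (f g h : X -> R) (A : set T).

Definition energy A f : R := fine (mu f A).

Definition E1cvg (u : nat -> X -> R) f :=
  [/\ forall n, F (u n), F f & E1 m E (u n \- f) @[n --> \oo] --> (0 : R)].

Lemma E1cvgD u v f g : E1cvg u f -> E1cvg v g -> E1cvg (fun n => u n \+ v n) (f \+ g).
Proof.
move=> [Fu Ff uf] [Fv Fg vg]; split; [move=> n; exact: (formD hF)|exact: (formD hF)|].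
apply: (@squeeze_cvgr _ _ _ _ (cst 0)
  (fun n => 2 * E1 m E (u n \- f) + 2 * E1 m E (v n \- g))).
- near=> n; have Fuv : F (u n \+ v n) by exact: (formD hF).
  have Ffg : F (f \+ g) by exact: (formD hF).
  rewrite /= (E1_ge0 hF); last exact: (formB hF).
  rewrite (_ : _ \- _ = (u n \- f) \+ (v n \- g)).
    by apply: (E1D_le hF); exact: (formB hF).
  by apply/funext => x /=; ring.
- exact: cvg_cst.
- rewrite -[X in _ --> X](addr0 (0 : R)) -[X in _ --> X + _](mulr0 2) -[X in _ --> _ + X](mulr0 2).
  by apply: cvgD; exact: cvgMr.
Unshelve. all: by end_near.
Qed.

Lemma E1cvgZ u f (c : R) : E1cvg u f -> E1cvg (fun n x => c * u n x) (fun x => c * f x).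
Proof.
move=> [Fu Ff uf]; split; [move=> n; exact: (formZ hF)|exact: (formZ hF)|].
rewrite (_ : (fun n => _) = (fun n => c ^+ 2 * E1 m E (u n \- f))).
  by rewrite -[X in _ --> X](mulr0 (c ^+ 2)); exact: cvgMr.
apply/funext => n; rewrite -(E1Z hF); last exact: (formB hF).
by congr E1; apply/funext => x /=; ring.
Qed.

Lemma energy_fin_num A f : measurable A -> F f -> mu f A \is a fin_num.
Proof.
move=> mA Ff; case: hmu => [/(_ _ Ff) fin _ _]; rewrite ge0_fin_numE//.
by apply: le_lt_trans fin; apply: le_measure; rewrite ?inE.
Qed.

Lemma bounded_approx f : F f -> exists u, E1cvg u f /\
  forall n, Cc (u n) /\ E1 m E (u n \- f) < n.+1%:R^-1.
Proof.
move=> Ff; have ex n : exists phi, [/\ F phi, Cc phi & E1 m E (phi \- f) < n.+1%:R^-1].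
  have [phi [Fphi Cphi] le] := hreg.1 f Ff n.+1%:R^-1 (ltac:(by rewrite invr_gt0)).
  by exists phi; split=> //; rewrite (E1BC hF).
have [u Hu] := choice ex; exists u; split; last by move=> n; have [] := Hu n.
split=> //; first by move=> n; have [] := Hu n.
apply: (@squeeze_cvgr _ _ _ _ (cst 0) (fun n => n.+1%:R^-1)).
- near=> n; have [Fun _ /ltW ->] := Hu n; rewrite andbT /=.
  by apply: (E1_ge0 hF); exact: (formB hF).
- exact: cvg_cst.
- exact: cvg_harmonic.
Unshelve. all: by end_near.
Qed.

Lemma energy_cvg_Cc A u f : measurable A -> E1cvg u f -> (forall n, Cc (u n)) ->
  energy A (u n) @[n --> \oo] --> energy A f.
Proof.
move=> mA [Fu Ff uf] Cu; apply: fine_cvg; rewrite fineK; last exact: energy_fin_num.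
case: hmu => _ _ /(_ f Ff u); apply => // n; split=> //.
by have [M uM] := Cc_bounded (Cu n); exists M; apply: aeW => x; exact: uM.
Qed.

(** The definition gives continuity only along bounded approximants. A diagonal choice replaces each
    u n by a function of C_c close to it both in E1 and in energy of A. *)
Lemma energy_cvg A u f : measurable A -> E1cvg u f ->
  energy A (u n) @[n --> \oo] --> energy A f.
Proof.
move=> mA [Fu Ff uf].
have ex n : exists phi, [/\ F phi, Cc phi, E1 m E (phi \- u n) < n.+1%:R^-1 &
    `|energy A (u n) - energy A phi| < n.+1%:R^-1].
  have [v [vu Hv]] := bounded_approx (Fu n).
  have n0 : 0 < n.+1%:R^-1 :> R by rewrite invr_gt0.
  have /cvgrPdist_lt/(_ _ n0)[N1 _ H1] := energy_cvg_Cc mA vu (fun k => (Hv k).1).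
  (* N1 secures closeness in energy, n secures closeness in E1. *)
  pose k := maxn N1 n; exists (v k); have [Ck Ek] := Hv k.
  split=> //; first by case: vu.
    apply: lt_le_trans Ek _; rewrite lef_pV2 ?posrE// ler_nat ltnS; exact: leq_maxr.
  by apply: H1; exact: leq_maxl.
have [v Hv] := choice ex.
have Fv n : F (v n) by case: (Hv n).
have vf : E1cvg v f.
  split=> //; apply: (@squeeze_cvgr _ _ _ _ (cst 0)
    (fun n => 2 * n.+1%:R^-1 + 2 * E1 m E (u n \- f))).
  - near=> n; rewrite /= (E1_ge0 hF); last exact: (formB hF).
    apply: le_trans (E1B_le hF (Fv n) (Fu n) Ff) _.
    by rewrite lerD2r ler_pM2l// ltW//; case: (Hv n).
  - exact: cvg_cst.
  - rewrite -[X in _ --> X](addr0 (0 : R)) -[X in _ --> X + _](mulr0 2) -[X in _ --> _ + X](mulr0 2).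
    by apply: cvgD; apply: cvgMr => //; exact: cvg_harmonic.
have cv := energy_cvg_Cc mA vf (fun n => let: And4 _ c _ _ := Hv n in c).
have cd : energy A (u n) - energy A (v n) @[n --> \oo] --> (0 : R).
  apply: norm_cvg0; apply: (@squeeze_cvgr _ _ _ _ (cst 0) (fun n => n.+1%:R^-1)).
  - by near=> n; rewrite normr_ge0/= ltW//; case: (Hv n).
  - exact: cvg_cst.
  - exact: cvg_harmonic.
rewrite -[X in _ --> X]add0r.
rewrite (_ : (fun n => energy A (u n)) =
  (fun n => energy A (u n) - energy A (v n) + energy A (v n))); first exact: cvgD.
by apply/funext => n; rewrite subrK.
Unshelve. all: by end_near.
Qed.

(** * Polarization of the defining formula against one test function *)

Section test_function.
Context (phi : X -> R) (Fphi : F phi) (Cphi : Cc phi).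

Let V f := F f /\ exists M, bounded_by f M.

Let V_mul f g : V f -> V g -> F (f \* g).
Proof. by move=> [Ff [M fM]] [Fg [N gN]]; exact: (form_mul hF Ff Fg fM gN). Qed.

Let Vphi : V phi.
Proof. by split=> //; exact: Cc_bounded. Qed.

Let VD f g : V f -> V g -> V (f \+ g).
Proof.
move=> [Ff [M fM]] [Fg [N gN]]; split; first exact: (formD hF).
by exists (M + N) => x; apply: le_trans (ler_normD _ _) _; exact: lerD.
Qed.

Let VZ (c : R) f : V f -> V (fun x => c * f x).
Proof.
move=> [Ff [M fM]]; split; first exact: (formZ hF).
by exists (`|c| * M) => x; rewrite normrM ler_wpM2l.
Qed.

(** The symmetric bilinear form whose diagonal is 2 E(f phi, f) - E(phi, f^2), that is, the integral
    of phi against mu_<f,g>. *)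
Let J f g := E (f \* phi) g + E (g \* phi) f - E phi (f \* g).

Let JC f g : V f -> V g -> J f g = J g f.
Proof.
move=> Vf Vg; rewrite /J (addrC (E (f \* phi) g)); congr (_ - E phi _).
by apply/funext => x /=; rewrite mulrC.
Qed.

Let JD f g h : V f -> V g -> V h -> J (f \+ g) h = J f h + J g h.
Proof.
move=> Vf Vg Vh; rewrite /J.
have -> : (f \+ g) \* phi = (f \* phi) \+ (g \* phi).
  by apply/funext => x /=; rewrite mulrDl.
have -> : (f \+ g) \* h = (f \* h) \+ (g \* h).
  by apply/funext => x /=; rewrite mulrDl.
rewrite (formDl hF); [|exact: V_mul|exact: V_mul|exact: Vh.1].
rewrite (formDr hF Vf.1 Vg.1); last exact: V_mul.
rewrite (formDr hF); [|exact: V_mul|exact: V_mul|by []].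
ring.
Qed.

Let JZ (c : R) f h : V f -> V h -> J (fun x => c * f x) h = c * J f h.
Proof.
move=> Vf Vh; rewrite /J.
have -> : (fun x => c * f x) \* phi = (fun x => c * (f \* phi) x).
  by apply/funext => x /=; rewrite mulrA.
have -> : (fun x => c * f x) \* h = (fun x => c * (f \* h) x).
  by apply/funext => x /=; rewrite mulrA.
rewrite (formZl hF); [|exact: V_mul|exact: Vh.1].
rewrite (formZr hF _ Vf.1); last exact: V_mul.
rewrite (formZr hF); [|exact: V_mul|by []].
ring.
Qed.

Let integralJ f : V f -> fine (\int[mu f]_x (phi x)%:E) = J f f.
Proof.
move=> [Ff [M fM]]; case: hmu => _ H _; rewrite H//.
  by rewrite /J/=; ring.
by exists M; apply: aeW.
Qed.

Let JDD f g : V f -> V g -> J (f \+ g) (f \+ g) = J f f + 2 * J f g + J g g.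
Proof.
move=> Vf Vg; have Vfg := VD Vf Vg.
rewrite JD// (JC Vf Vfg) (JC Vg Vfg) !JD// (JC Vg Vf); ring.
Qed.

(** This is mu_<f+tg,h> = mu_<f,h> + t mu_<g,h> tested on phi and doubled, with each mixed term
    expanded so that only the positive measures mu_<u> occur; the two terms I(h) with coefficient 1
    cancel. *)
Lemma integral_energy_bilinear (t : R) f g h :
  F f -> F g -> F h -> Cc f -> Cc g -> Cc h ->
  let I u := fine (\int[mu u]_x (phi x)%:E) in
  let tg := fun x => t * g x in
  I (f \+ tg \+ h) - I (f \+ tg) - I (f \+ h) + I f - t * I (g \+ h) + t * I g + t * I h = 0.
Proof.
move=> Ff Fg Fh Cf Cg Ch I tg.
have Vf : V f by split=> //; exact: Cc_bounded.
have Vg : V g by split=> //; exact: Cc_bounded.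
have Vh : V h by split=> //; exact: Cc_bounded.
have Vtg := VZ t Vg; have Vftg := VD Vf Vtg.
rewrite /I !integralJ//; try by do ?apply: VD.
rewrite !JDD//; try by do ?apply: VD.
rewrite !JD// (JC Vf Vtg) !JZ// (JC Vg Vtg) !JZ//; ring.
Qed.

Lemma integral_energy_double f : F f -> Cc f ->
  fine (\int[mu (f \+ f)%R]_x (phi x)%:E) = 4 * fine (\int[mu f]_x (phi x)%:E).
Proof.
move=> Ff Cf; have Vf : V f by split=> //; exact: Cc_bounded.
by rewrite !integralJ ?JDD//; [ring|exact: VD].
Qed.

End test_function.

(** Indices carry a proof of membership in F because uniqueness requires every measure of the family
    to be finite, which is known only on F. *)
Lemma energy_comb_Cc (s : seq (R * {f | F f})) :
  (forall phi, F phi -> Cc phi ->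
    \sum_(i <- s) i.1 * fine (\int[mu (sval i.2)]_x (phi x)%:E) = 0) ->
  forall A, measurable A -> \sum_(i <- s) i.1 * energy A (sval i.2) = 0.
Proof.
move=> H A mA; case: met => dist [d0 deq dsym dtri dopen].
apply: (@comb_measure_unique R X dist d0 deq dsym dtri dopen lc sep _ s
  fst (fun i => mu (sval i.2)) _ (fun phi => F phi /\ Cc phi)) => //.
- by case=> c [f Ff]; case: hmu => + _ _; exact.
- by move=> phi [].
- exact: hreg.2.
- by move=> phi [Fphi Cphi]; exact: H.
Qed.

(** On F with compact support the identity holds against every test function, hence on Borel sets;
    E1-density and continuity of the energy of A extend it to F. *)
Lemma energy_bilinear (t : R) f g h A : F f -> F g -> F h -> measurable A ->
  let tg := fun x => t * g x in
  energy A (f \+ tg \+ h) - energy A (f \+ tg) - energy A (f \+ h) + energy A f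
  - t * energy A (g \+ h) + t * energy A g + t * energy A h = 0.
Proof.
move=> Ff Fg Fh mA tg.
have [u [uf Hu]] := bounded_approx Ff; have [v [vg Hv]] := bounded_approx Fg.
have [w [wh Hw]] := bounded_approx Fh.
have vtg := E1cvgZ t vg.
have c1 := energy_cvg mA (E1cvgD (E1cvgD uf vtg) wh).
have c2 := energy_cvg mA (E1cvgD uf vtg).
have c3 := energy_cvg mA (E1cvgD uf wh).
have c4 := energy_cvg mA uf.
have c5 := energy_cvg mA (E1cvgD vg wh).
have c6 := energy_cvg mA vg.
have c7 := energy_cvg mA wh.
have cM (c : R) (a : nat -> R) (l : R) : a n @[n --> \oo] --> l ->
  c * a n @[n --> \oo] --> c * l by move=> al; exact: cvgMr.
pose G n := energy A (u n \+ (fun x => t * v n x) \+ w n) -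
  energy A (u n \+ (fun x => t * v n x)) - energy A (u n \+ w n) + energy A (u n) -
  t * energy A (v n \+ w n) + t * energy A (v n) + t * energy A (w n).
have cv : G n @[n --> \oo] --> energy A (f \+ tg \+ h) - energy A (f \+ tg) -
    energy A (f \+ h) + energy A f - t * energy A (g \+ h) + t * energy A g + t * energy A h.
  exact: (cvgD (cvgD (cvgB (cvgD (cvgB (cvgB c1 c2)
  c3) c4) (cM t _ _ c5)) (cM t _ _ c6)) (cM t _ _ c7)).
rewrite -(cvg_lim (@Rhausdorff R) cv) (_ : G = cst 0) ?lim_cst//.
apply/funext => n; rewrite /G /=.
have Fu : F (u n) by case: uf.
have Fv : F (v n) by case: vg.
have Fw : F (w n) by case: wh.
have Ftv := formZ hF t Fv; have Futv := formD hF Fu Ftv.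
have := @energy_comb_Cc [::
  (1, exist _ _ (formD hF Futv Fw)); (-1, exist _ _ Futv);
  (-1, exist _ _ (formD hF Fu Fw)); (1, exist _ _ Fu);
  (- t, exist _ _ (formD hF Fv Fw)); (t, exist _ _ Fv); (t, exist _ _ Fw)] _ A mA.
rewrite !big_cons !big_nil/= => <-; first by ring.
move=> phi Fphi Cphi; rewrite !big_cons !big_nil/=.
rewrite -[RHS](integral_energy_bilinear Fphi Cphi t Fu Fv Fw (Hu n).1 (Hv n).1 (Hw n).1); ring.
Qed.

Lemma energy_double f A : F f -> measurable A -> energy A (f \+ f) = 4 * energy A f.
Proof.
move=> Ff mA; have [u [uf Hu]] := bounded_approx Ff.
have c1 := energy_cvg mA (E1cvgD uf uf).
have c2 : 4 * energy A (u n) @[n --> \oo] --> 4 * energy A f.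
  by apply: cvgMr; exact: energy_cvg.
apply/eqP; rewrite -subr_eq0; apply/eqP.
pose G n := energy A (u n \+ u n) - 4 * energy A (u n).
have cv : G n @[n --> \oo] --> energy A (f \+ f) - 4 * energy A f by exact: (cvgB c1 c2).
rewrite -(cvg_lim (@Rhausdorff R) cv) (_ : G = cst 0) ?lim_cst//.
apply/funext => n; rewrite /G /=.
have Fu : F (u n) by case: uf.
have := @energy_comb_Cc [:: (1, exist _ _ (formD hF Fu Fu)); (-4, exist _ _ Fu)] _ A mA.
rewrite !big_cons !big_nil/= => <-; first by ring.
move=> phi Fphi Cphi; rewrite !big_cons !big_nil/=.
by rewrite (integral_energy_double Fphi Cphi Fu (Hu n).1); ring.
Qed.

Lemma energy0 A : measurable A -> energy A (fun=> 0) = 0.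
Proof.
move=> mA; have := energy_double (form0 hF) mA.
rewrite (_ : _ \+ _ = (fun=> 0)); first lra.
by apply/funext => x /=; rewrite addr0.
Qed.

Lemma energy_ge0 A f : 0 <= energy A f.
Proof. exact: fine_ge0. Qed.

(** Sequential continuity at 0, turned by contradiction into a modulus that does not depend on f. *)
Lemma energy_small A (e : R) : measurable A -> 0 < e ->
  exists2 d : R, 0 < d & forall f, F f -> E1 m E f < d -> energy A f < e.
Proof.
move=> mA e0; apply: contrapT => H.
have ex n : exists f, [/\ F f, E1 m E f < n.+1%:R^-1 & e <= energy A f].
  apply: contrapT => Hn; apply: H; exists n.+1%:R^-1; first by rewrite invr_gt0.
  move=> f Ff fd; rewrite ltNge; apply/negP => fe; apply: Hn; by exists f.
have [u Hu] := choice ex.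
have u0 : E1cvg u (fun=> 0).
  split; [by move=> n; case: (Hu n)|exact: (form0 hF)|].
  apply: (@squeeze_cvgr _ _ _ _ (cst 0) (fun n => n.+1%:R^-1)).
  - near=> n; have [Fun /ltW un _] := Hu n.
    rewrite (_ : _ \- _ = u n); last by apply/funext => x /=; rewrite subr0.
    by rewrite (E1_ge0 hF Fun).
  - exact: cvg_cst.
  - exact: cvg_harmonic.
have := energy_cvg mA u0; rewrite energy0// => /cvgrPdist_lt/(_ _ e0)[N _ /(_ N (leqnn N))].
rewrite /= sub0r normrN ger0_norm ?energy_ge0//.
by have [_ _] := Hu N; rewrite leNgt => /negP.
Unshelve. all: by end_near.
Qed.

End energy_quadratic.

(** * Densities of energy measures *)

Section energy_densities.
Context (R : realType) (X : ptopologicalType).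
Local Notation T := (borel X).
Context (m : {measure set T -> \bar R}) (E : (X -> R) -> (X -> R) -> R).
Context (F : set (X -> R)) (mu : (X -> R) -> {measure set T -> \bar R}).
Context (nu : {measure set T -> \bar R}) (rho : (X -> R) -> X -> R).
Context (lc : locally_compact [set: X]) (sep : separable_space X) (met : metrizable R X).
Context (hF : dirichlet_form m E F) (hreg : regular_form m E F).
Context (hmu : energy_measures m E F mu) (hrho : densities F mu nu rho).
Implicit Types (f g h : X -> R) (A : set T).

Lemma dens_measurable f : F f -> measurable_fun [set: T] (rho f : T -> R).
Proof. by move=> /hrho[]. Qed.

Lemma dens_ge0 f x : F f -> 0 <= rho f x.
Proof. by move=> /hrho[_ + _]; exact. Qed.

Lemma dens_integral f A : F f -> measurable A ->
  (\int[nu]_(x in A) (rho f x)%:E = (energy mu A f)%:E)%E.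
Proof.
move=> Ff mA; have [_ _ <-//] := hrho Ff.
by rewrite /energy fineK//; exact: (energy_fin_num hmu).
Qed.

Lemma dens_integrable f : F f -> nu.-integrable [set: T] (fun x => (rho f x)%:E).
Proof.
move=> Ff; apply/integrableP; split.
  by apply/measurable_EFinP; exact: dens_measurable.
under eq_integral do rewrite gee0_abs ?lee_fin ?dens_ge0//.
by rewrite dens_integral// ltry.
Qed.

(** A linear relation between energies on all Borel sets says that the same combination of densities
    has zero integral over every Borel set, so it vanishes a.e. *)
Lemma dens_comb_ae (s : seq (R * {f | F f})) :
  (forall A, measurable A -> \sum_(i <- s) i.1 * energy mu A (sval i.2) = 0) ->
  {ae nu, forall x : T, \sum_(i <- s) i.1 * rho (sval i.2) x = 0}.
Proof.
move=> H.
have [hi hA] : nu.-integrable [set: T] (fun x => (\sum_(i <- s) i.1 * rho (sval i.2) x)%:E) /\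
    forall A, measurable A -> (\int[nu]_(x in A) (\sum_(i <- s) i.1 * rho (sval i.2) x)%:E =
      (\sum_(i <- s) i.1 * energy mu A (sval i.2))%:E)%E.
  elim: s {H} => [|[c [f Ff]] s [IHi IHA]].
    under eq_fun do rewrite big_nil; split; first exact: integrable0.
    by move=> A mA; rewrite big_nil integral0.
  have ci : nu.-integrable [set: T] (fun x => (c%:E * (rho f x)%:E)%E).
    by apply: integrableZl => //; exact: dens_integrable.
  have eq : (fun x => (\sum_(i <- (c, exist _ f Ff) :: s) i.1 * rho (sval i.2) x)%:E) =
      (fun x => (c%:E * (rho f x)%:E)%E + (\sum_(i <- s) i.1 * rho (sval i.2) x)%:E)%E.
    by apply/funext => x; rewrite big_cons EFinD EFinM.
  split; first by rewrite eq; exact: integrableD.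
  move=> A mA; rewrite [X in integral _ _ X]eq integralD//; last 2 first.
  - exact: integrableS ci.
  - exact: integrableS IHi.
  rewrite IHA// integralZl//; last first.
    by apply: integrableS (dens_integrable Ff).
  by rewrite dens_integral// big_cons EFinD EFinM.
have := integral_ae_eq measurableT hi (measurable_cst (0%E : \bar R)).
have H0 (A : set T) : A `<=` setT -> measurable A ->
    (\int[nu]_(x in A) (\sum_(i <- s) i.1 * rho (sval i.2) x)%:E = \int[nu]_(x in A) cst 0 x)%E.
  by move=> _ mA; rewrite hA// H// integral0.
by move=> /(_ H0); apply: filterS => x /(_ I) /= [].
Qed.

Lemma mdensC f g x : mdens rho f g x = mdens rho g f x.
Proof.
rewrite /mdens (_ : f \+ g = g \+ f); first by congr (_ / _); ring.
by apply/funext => y /=; rewrite addrC.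
Qed.

Lemma mdens_bilinear (t : R) f g h : F f -> F g -> F h ->
  {ae nu, forall x : T, mdens rho (f \+ (fun y => t * g y)) h x =
    mdens rho f h x + t * mdens rho g h x}.
Proof.
move=> Ff Fg Fh; have Ftg := formZ hF t Fg; have Fftg := formD hF Ff Ftg.
pose s : seq (R * {f | F f}) := [::
  (1, exist _ _ (formD hF Fftg Fh)); (-1, exist _ _ Fftg);
  (-1, exist _ _ (formD hF Ff Fh)); (1, exist _ _ Ff);
  (- t, exist _ _ (formD hF Fg Fh)); (t, exist _ _ Fg); (t, exist _ _ Fh)].
have H A : measurable A -> energy mu A (f \+ (fun x => t * g x) \+ h) -
    energy mu A (f \+ (fun x => t * g x)) - energy mu A (f \+ h) + energy mu A f -
    t * energy mu A (g \+ h) + t * energy mu A g + t * energy mu A h = 0.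
  by move=> mA; exact: (energy_bilinear lc sep met hF hreg hmu t Ff Fg Fh mA).
have Hs A : measurable A -> \sum_(i <- s) i.1 * energy mu A (sval i.2) = 0.
  by move=> mA; rewrite !big_cons !big_nil/= -[RHS](H A mA); ring.
have := dens_comb_ae Hs; apply: filterS => x; rewrite !big_cons !big_nil/= /mdens => H0.
apply/eqP; rewrite -subr_eq0; apply/eqP; apply: (@mulfI _ 2) => //.
by rewrite mulr0 -[RHS]H0; field.
Qed.

Lemma mdens_diag f : F f -> {ae nu, forall x : T, mdens rho f f x = rho f x}.
Proof.
move=> Ff; pose s : seq (R * {f | F f}) := [:: (1, exist _ _ (formD hF Ff Ff)); (-4, exist _ _ Ff)].
have Hs A : measurable A -> \sum_(i <- s) i.1 * energy mu A (sval i.2) = 0.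
  move=> mA; rewrite !big_cons !big_nil/=.
  by rewrite (energy_double lc sep met hF hreg hmu Ff mA); ring.
have := dens_comb_ae Hs; apply: filterS => x; rewrite !big_cons !big_nil/= /mdens => H0; lra.
Qed.

Lemma mdens_quad (t : R) f g f' g' : F f -> F g -> F f' -> F g' ->
  {ae nu, forall x : T, mdens rho (f \+ (fun y => t * g y)) (f' \+ (fun y => t * g' y)) x =
    mdens rho f f' x + (mdens rho f g' x + mdens rho g f' x) * t + mdens rho g g' x * t ^+ 2}.
Proof.
move=> Ff Fg Ff' Fg'; have Fh := formD hF Ff' (formZ hF t Fg').
have b1 := mdens_bilinear t Ff Fg Fh.
have b2 := mdens_bilinear t Ff' Fg' Ff.
have b3 := mdens_bilinear t Ff' Fg' Fg.
apply: filterS2 (filterI b1 b2) b3 => x [-> e2] e3.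
rewrite (mdensC f) (mdensC g) e2 e3 (mdensC f' f) (mdensC g' f) (mdensC f' g) (mdensC g' g).
ring.
Qed.

(** Nonnegativity of the density of f + t g for t = 1/(k+1) and t = -1/(k+1), multiplied by k+1.
    Countably many weights share one null set, and they suffice wherever Cauchy-Schwarz would be
    used. *)
Lemma mdens_young f g : F f -> F g ->
  {ae nu, forall x : T, forall k : nat,
    2 * `|mdens rho f g x| <= k.+1%:R * rho f x + rho g x / k.+1%:R}.
Proof.
move=> Ff Fg.
have key (t : R) : {ae nu, forall x : T,
    0 <= rho f x + 2 * t * mdens rho f g x + t ^+ 2 * rho g x}.
  have Fh := formD hF Ff (formZ hF t Fg).
  have q := mdens_quad t Ff Fg Ff Fg; have d := mdens_diag Fh.
  have d1 := mdens_diag Ff; have d2 := mdens_diag Fg.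
  apply: filterS2 (filterI q d) (filterI d1 d2) => x [e1 e2] [e3 e4].
  by rewrite e2 e3 e4 (mdensC g f) in e1; have := dens_ge0 x Fh; rewrite e1; lra.
apply: ae_foralln => k.
apply: filterS2 (key k.+1%:R^-1) (key (- k.+1%:R^-1)) => x h1 h2.
have k0 : 0 < k.+1%:R :> R by [].
move: h1 h2; rewrite -(pmulr_rge0 _ k0) => h1; rewrite -(pmulr_rge0 _ k0) => h2.
have kV : k.+1%:R * k.+1%:R^-1 = 1 :> R by rewrite divff// gt_eqF.
set b := k.+1%:R in kV h1 h2 *; set c := b^-1 in kV h1 h2 *.
have e1 : b * (rho f x + 2 * c * mdens rho f g x + c ^+ 2 * rho g x) =
    b * rho f x + 2 * mdens rho f g x * (b * c) + (b * c) * (rho g x * c) by ring.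
have e2 : b * (rho f x + 2 * (- c) * mdens rho f g x + (- c) ^+ 2 * rho g x) =
    b * rho f x - 2 * mdens rho f g x * (b * c) + (b * c) * (rho g x * c) by ring.
rewrite e1 kV in h1; rewrite e2 kV in h2.
by case: (ger0P (mdens rho f g x)) => _; lra.
Qed.

End energy_densities.

(** * Minors and measure-theoretic preliminaries *)

Section weighted_minor.

Definition lead_block (K : Type) (n : nat) (M : nat -> nat -> K) : 'M[K]_n :=
  \matrix_(i < n, j < n) M i j.

(* Nonvanishing of wdet p n encodes both requirements on a tuple at a point of
   pointwise index n: the leading block is invertible and all p energy densities
   are nonzero. *)
Definition wdet (K : comNzRingType) (p n : nat) (M : nat -> nat -> K) : K :=
  \det (lead_block n M) * \prod_(i < p) M i i.

(** If A and C are the Gram matrices of two tuples and B collects their cross terms, evaluation at t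
    gives the Gram matrix of the first tuple plus t times the second. *)
Definition quad_poly (K : comNzRingType) (A B C : nat -> nat -> K) (i j : nat) : {poly K} :=
  (A i j)%:P + (B i j)%:P * 'X + (C i j)%:P * 'X^2.

Lemma horner_quad_poly (K : comNzRingType) (A B C : nat -> nat -> K) i j t :
  (quad_poly A B C i j).[t] = A i j + B i j * t + C i j * t ^+ 2.
Proof. by rewrite /quad_poly !hornerE. Qed.

Lemma horner_det_quad (K : comNzRingType) n (A B C : nat -> nat -> K) t :
  (\det (lead_block n (quad_poly A B C))).[t] =
  \det (lead_block n (fun i j => A i j + B i j * t + C i j * t ^+ 2)).
Proof.
rewrite -[LHS]/(horner_eval t _) -det_map_mx; congr (\det _).
by apply/matrixP => i j; rewrite !mxE /= /horner_eval horner_quad_poly.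
Qed.

Lemma horner_wdet_quad (K : comNzRingType) p n (A B C : nat -> nat -> K) t :
  (wdet p n (quad_poly A B C)).[t] =
  wdet p n (fun i j => A i j + B i j * t + C i j * t ^+ 2).
Proof.
rewrite /wdet hornerM horner_det_quad horner_prod; congr (_ * _).
by apply: eq_bigr => i _; rewrite horner_quad_poly.
Qed.

Lemma eq_wdet (K : comNzRingType) p n (M M' : nat -> nat -> K) : (n <= p)%N ->
  (forall i j, (i < p)%N -> (j < p)%N -> M i j = M' i j) -> wdet p n M = wdet p n M'.
Proof.
move=> np MM; rewrite /wdet; congr (\det _ * _).
  by apply/matrixP => i j; rewrite !mxE MM// (leq_trans _ np).
by apply: eq_bigr => i _; rewrite MM.
Qed.

Lemma wdetZ (K : comNzRingType) p n (c : K) M :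
  wdet p n (fun i j => c * M i j) = c ^+ (n + p) * wdet p n M.
Proof.
rewrite /wdet (_ : lead_block n _ = c *: lead_block n M).
  by rewrite detZ big_split prodr_const card_ord exprD/=; ring.
by apply/matrixP => i j; rewrite !mxE.
Qed.

Lemma cvg_prod_seq (R : realType) (J : Type) (r : seq J) (f : J -> nat -> R) (l : J -> R) :
  (forall i, f i n @[n --> \oo] --> l i) ->
  \prod_(i <- r) f i n @[n --> \oo] --> \prod_(i <- r) l i.
Proof.
move=> fl; elim: r => [|i r IH].
  by rewrite big_nil; under eq_fun do rewrite big_nil; exact: cvg_cst.
by rewrite big_cons; under eq_fun do rewrite big_cons; exact: cvgM.
Qed.

Lemma cvg_wdet (R : realType) p n (M : nat -> nat -> nat -> R) (L : nat -> nat -> R) :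
  (n <= p)%N ->
  (forall i j, (i < p)%N -> (j < p)%N -> M k i j @[k --> \oo] --> L i j) ->
  wdet p n (M k) @[k --> \oo] --> wdet p n L.
Proof.
move=> np ML; rewrite /wdet; apply: cvgM.
  apply: cvg_sum_seq => s; apply: cvgMr; apply: cvg_prod_seq => i.
  rewrite mxE; under eq_fun do rewrite mxE.
  by apply: ML; apply: leq_trans np.
by apply: cvg_prod_seq => i; exact: ML.
Qed.

(** An injective sequence meets the finite root set only finitely often. *)
Lemma poly_eventually_neq0 (R : realType) (P : {poly R}) (s : nat -> R) :
  P != 0 -> injective s -> exists N, forall n, (N <= n)%N -> P.[s n] != 0.
Proof.
move=> P0 sinj; apply: contrapT => H.
have nx N : exists n, (N <= n)%N /\ root P (s n).
  apply: contrapT => HN; apply: H; exists N => n Nn; apply/negP => rn.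
  by apply: HN; exists n.
have [f Hf] := choice nx.
(* Strictly increasing indices at which s hits a root; the first [size P] of them are already too
   many roots. *)
pose a k := iter k (fun n => f n.+1) (f 0%N).
have aS k : (a k < a k.+1)%N by rewrite /a iterS; have [] := Hf (a k).+1.
have ainj : {homo a : i j / (i < j)%N} by exact: (homo_ltn ltn_trans).
have ra k : root P (s (a k)) by case: k => [|k]; [have [] := Hf 0%N|rewrite /a iterS; have [] := Hf (a k).+1].
have := @max_poly_roots _ P [seq s (a k) | k <- iota 0 (size P)] P0.
rewrite size_map size_iota ltnn => H'.
suff : false by [].
apply: H'; first by apply/allP => _ /mapP[k _ ->].
rewrite map_inj_uniq ?iota_uniq// => i j /sinj; case: (ltngtP i j) => // /ainj + e;
  by rewrite e ltnn.
Qed.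

(** Fix k with b/(k+1) < e first, then take n so large that (k+1) a n < e. *)
Lemma young_cvg0 (R : realType) (a c : nat -> R) (b : R) : 0 <= b ->
  (forall n, 0 <= a n) -> a n @[n --> \oo] --> (0 : R) ->
  (forall n k, 2 * `|c n| <= k.+1%:R * a n + b / k.+1%:R) ->
  c n @[n --> \oo] --> (0 : R).
Proof.
move=> b0 a0 ac H; apply/cvgrPdist_lt => e e0.
pose k := Num.truncn (b / e); have k0 : 0 < k.+1%:R :> R by [].
have bk : b / k.+1%:R < e.
  rewrite ltr_pdivrMr// mulrC -ltr_pdivrMr//.
  by apply: truncnS_gt; rewrite ?num_real// divr_ge0// ltW.
have ek : 0 < e / k.+1%:R by rewrite divr_gt0.
have /cvgrPdist_lt/(_ _ ek)[N _ HN] := ac.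
exists N => // n /HN /=; rewrite !sub0r !normrN (ger0_norm (a0 n)) => an.
have ke : k.+1%:R * a n < e by rewrite mulrC -ltr_pdivlMr.
by have := le_lt_trans (H n k) (ltrD ke bk); clear; lra.
Qed.

(* For a symmetric matrix, a maximal set of independent rows indexes an
   invertible principal submatrix. *)
Lemma sym_principal_minor (K : fieldType) (N : nat) (G : 'M[K]_N) : G^T = G ->
  exists f : 'I_(\rank G) -> 'I_N, \det (\matrix_(i, j) G (f i) (f j)) != 0.
Proof.
move=> Gsym; exists (maxrankfun G); set f := maxrankfun G.
set Rw := rowsub f G.
have [Q GQ] : exists Q, G = Q *m Rw.
  by apply/submxP; rewrite (eq_maxrowsub G).
set M := \matrix_(i, j) _.
have RwM : Rw = M^T *m Q^T.
  transitivity (rowsub f (Rw^T *m Q^T)); first by rewrite -trmx_mul -GQ Gsym.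
  rewrite -mul_rowsub_mx; congr (_ *m _).
  by apply/matrixP => i j; rewrite !mxE.
have : row_free Rw by exact: maxrowsub_free.
rewrite /row_free => /eqP rk.
have : (\rank Rw <= \rank M^T)%N by rewrite {1}RwM; exact: mxrankM_maxl.
rewrite rk mxrank_tr => le.
have : M \in unitmx by rewrite -row_free_unit /row_free eqn_leq rank_leq_row.
by rewrite unitmxE unitfE.
Qed.

End weighted_minor.

(** * Limits almost everywhere and equivalent finite measures *)

Section measure_tools.
Context (d : measure_display) (T : measurableType d) (R : realType).

Lemma half_eseries_le1 : (\sum_(0 <= i <oo) (1 / (2 ^ i.+1)%:R)%:E <= 1 :> \bar R)%E.
Proof.
have := @epsilon_trick R (fun=> 0%E) 1 xpredT (fun=> lexx _) ler01.
rewrite [X in (_ <= X + _)%E]eseries0// add0e; apply: le_trans.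
by apply: lee_nneseries => // i _; rewrite add0e.
Qed.

(** The upper limit of the sets is null, and finiteness of [kap] gives continuity from above along
    the unions of tails. *)
Lemma ae_eventually_out_small (kap : {measure set T -> \bar R}) (A : nat -> set T) :
  (kap setT < +oo)%E -> (forall n, measurable (A n)) ->
  {ae kap, forall x, exists N, forall n, (N <= n)%N -> ~ A n x} ->
  forall e : R, 0 < e -> exists N, forall n, (N <= n)%N -> fine (kap (A n)) < e.
Proof.
move=> fin mA aeA e e0.
have mU n : measurable (\bigcup_(k in [set k | (n <= k)%N]) A k) by exact: bigcup_measurable.
have Ufin n : (kap (\bigcup_(k in [set k | (n <= k)%N]) A k) < +oo)%E.
  by apply: le_lt_trans fin; apply: le_measure; rewrite ?inE.
have := lim_sup_set_cvg kap A mA (Ufin 0%N).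
have -> : kap (lim_sup_set A) = 0%E.
  apply/negligibleP.
    by apply: bigcap_measurable => // n _; exact: mU.
  apply: negligibleS aeA => x Lx /= [N HN].
  by have [n Nn An] := Lx N I; exact: (HN n Nn).
move=> /fine_cvg /cvgrPdist_lt /(_ _ e0)[N _ HN].
exists N => n Nn; have := HN n Nn; rewrite /= sub0r normrN ger0_norm ?fine_ge0//.
apply: le_lt_trans; apply: fine_le.
- rewrite ge0_fin_numE//; apply: le_lt_trans fin; apply: le_measure; rewrite ?inE//.
- by rewrite ge0_fin_numE.
- by apply: le_measure; rewrite ?inE//; apply: bigcup_sup => /=.
Qed.

(** The sum of the f n has integral at most 1, so it is finite a.e. and its terms tend to 0. *)
Lemma ae_cvg0_of_summable (nu : {measure set T -> \bar R}) (f : nat -> T -> R) :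
  (forall n, measurable_fun setT (f n)) -> (forall n x, 0 <= f n x) ->
  (forall n, (\int[nu]_x (f n x)%:E <= (1 / (2 ^ n.+1)%:R)%:E)%E) ->
  {ae nu, forall x, f n x @[n --> \oo] --> (0 : R)}.
Proof.
move=> mf f0 H.
have mfE n : measurable_fun setT (fun x => (f n x)%:E) by apply/measurable_EFinP.
have f0E n (x : T) : [set: T] x -> (0 <= (f n x)%:E)%E by rewrite lee_fin.
have s0 x : (0 <= \sum_(0 <= n <oo) (f n x)%:E)%E.
  by apply: nneseries_ge0 => n _ _; rewrite lee_fin.
have int : nu.-integrable setT (fun x => \sum_(0 <= n <oo) (f n x)%:E)%E.
  apply/integrableP; split.
    by apply: (@ge0_emeasurable_sum _ _ _ setT (fun n x => (f n x)%:E) xpredT) => // k x *; exact: f0E.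
  under eq_integral do rewrite gee0_abs//.
  rewrite integral_nneseries//; apply: (@le_lt_trans _ _ 1%E); last exact: ltry.
  apply: le_trans half_eseries_le1; apply: lee_nneseries => // n _ _.
  by apply: integral_ge0 => x _; rewrite lee_fin.
have := integrable_ae measurableT int; apply: filterS => x /(_ I).
rewrite ge0_fin_numE// => fx.
have tail := nneseries_tail_cvg fx (fun n _ => f0E n x I).
have : (f n x)%:E @[n --> \oo] --> 0%E.
  apply: (squeeze_cvge _ (cvg_cst 0%E) tail); near=> n.
  rewrite lee_fin f0/=; apply: le_trans (nneseries_lim_ge n.+1 _) => //.
    by rewrite big_nat1.
  by move=> k _ _; rewrite lee_fin.
by move/fine_cvg.
Unshelve. all: by end_near.
Qed.

Lemma sigma_finite_equiv_finite (nu : {measure set T -> \bar R}) :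
  sigma_finite setT nu ->
  exists kap : {measure set T -> \bar R},
    [/\ (kap setT < +oo)%E, kap `<< nu & nu `<< kap].
Proof.
move=> [G GT mG].
(* The piece G k then contributes at most 2^-(k+1); adding 1 covers the case of a null piece. *)
pose c k : R := (1 / (2 ^ k.+1)%:R) / (1 + fine (nu (G k))).
have c0 k : 0 < c k.
  by rewrite divr_gt0// ?divr_gt0 ?ltr0n ?expn_gt0// ltr_wpDr// fine_ge0.
pose ms k : {measure set T -> \bar R} :=
  mscale (NngNum (ltW (c0 k))) (mrestr nu (mG k).1).
pose kap : {measure set T -> \bar R} := mseries ms 0.
have msE k A : ms k A = ((c k)%:E * nu (A `&` G k))%E by [].
have kapE A : kap A = (\sum_(0 <= k <oo) ms k A)%E by [].
exists kap; split.
- apply: (@le_lt_trans _ _ 1%E); last exact: ltry.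
  rewrite kapE; apply: le_trans half_eseries_le1; apply: lee_nneseries => // k _.
  rewrite msE setTI -(fineK (_ : nu (G k) \is a fin_num)); last first.
    by rewrite ge0_fin_numE//; exact: (mG k).2.
  have n0 : 0 <= fine (nu (G k)) by rewrite fine_ge0.
  have p0 : 0 <= 1 / (2 ^ k.+1)%:R :> R by [].
  rewrite -EFinM lee_fin /c; set a : R := 1 / (2 ^ k.+1)%:R in p0 *.
  by rewrite -(mulrA a) ler_piMr// mulrC ler_pdivrMr ?mul1r; lra.
- apply/null_content_dominatesP => A mA A0; rewrite kapE eseries0// => k _ _.
  rewrite msE (_ : nu (A `&` G k) = 0%E) ?mule0//.
  apply/eqP; rewrite eq_le measure_ge0 andbT -A0; apply: le_measure; rewrite ?inE//.
  by apply: measurableI => //; exact: (mG k).1.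
- apply/null_content_dominatesP => A mA A0.
  have AG k : nu (A `&` G k) = 0%E.
    have : ms k A = 0%E.
      apply/eqP; rewrite eq_le measure_ge0 andbT.
      apply: (@le_trans _ _ (kap A)); last by rewrite A0.
      rewrite kapE; apply: le_trans (nneseries_lim_ge k.+1 _) => //.
      by rewrite big_nat_recr//= leeDr// sume_ge0.
    rewrite msE => /eqP; rewrite mule_eq0 eqe gt_eqF//= => /eqP//.
  rewrite -(setIT A) GT setI_bigcupr; apply/eqP; rewrite eq_le measure_ge0 andbT.
  have mAG k : measurable (A `&` G k) by apply: measurableI => //; exact: (mG k).1.
  apply: le_trans (generalized_Boole_inequality nu mAG _) _.
    exact: bigcup_measurable.
  by rewrite eseries0.
Qed.

End measure_tools.

(** * Tuples of maximal rank *)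

Section good_points.
Context (R : realType) (X : ptopologicalType).
Local Notation T := (borel X).
Context (m : {measure set T -> \bar R}) (E : (X -> R) -> (X -> R) -> R).
Context (F : set (X -> R)) (mu : (X -> R) -> {measure set T -> \bar R}).
Context (nu : {measure set T -> \bar R}) (rho : (X -> R) -> X -> R).
Context (lc : locally_compact [set: X]) (sep : separable_space X) (met : metrizable R X).
Context (hF : dirichlet_form m E F) (hreg : regular_form m E F).
Context (hmu : energy_measures m E F mu) (hrho : densities F mu nu rho).
Context (q : T -> \bar R) (mq : measurable_fun [set: T] q) (p : nat).
Context (kap : {measure set T -> \bar R}) (kapfin : (kap setT < +oo)%E) (kapnu : kap `<< nu).
Implicit Types (f : X -> R) (g h : nat -> X -> R) (A : set T).

Definition tupleF g := forall i, (i < p)%N -> F (g i).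

Definition gram g (x : X) (i j : nat) : R := mdens rho (g i) (g j) x.

(** The bound n <= p keeps the leading block within the components that [tupleF] puts in F; points
    where q is infinite or exceeds p are never good. *)
Definition good g : set T := [set x | exists n,
  [/\ (n <= p)%N, q x = (n%:R)%:E & wdet p n (gram g x) != 0]].

Lemma ae_dominated (m1 m2 : {measure set T -> \bar R}) (P : T -> Prop) : m1 `<< m2 ->
  {ae m2, forall x, P x} -> {ae m1, forall x, P x}.
Proof.
move=> m12 [A [mA A0 PA]]; exists A; split=> //.
by move/null_content_dominatesP : m12; exact.
Qed.

Lemma ae_forall_lt (k : nat) (P : nat -> T -> Prop) :
  (forall i, (i < k)%N -> {ae nu, forall x, P i x}) ->
  {ae nu, forall x, forall i, (i < k)%N -> P i x}.
Proof.
move=> H; apply: ae_foralln => i; case: (ltnP i k) => [ik|_]; last exact: aeW.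
by apply: filterS (H i ik) => x Px _.
Qed.

Lemma kap_fin A : measurable A -> kap A \is a fin_num.
Proof.
move=> mA; rewrite ge0_fin_numE//; apply: le_lt_trans kapfin.
by apply: le_measure; rewrite ?inE.
Qed.

Lemma mdens_measurable f f' : F f -> F f' ->
  measurable_fun [set: T] (mdens rho f f' : T -> R).
Proof.
move=> Ff Ff'; apply: measurable_funM => //.
by apply: measurable_funB; [apply: measurable_funB|]; apply: (dens_measurable hrho) => //;
  exact: (formD hF).
Qed.

Lemma measurable_index n : measurable [set x : T | q x = (n%:R)%:E].
Proof.
rewrite (_ : [set _ | _] = q @^-1` [set (n%:R)%:E])//.
by rewrite -[X in measurable X]setTI; apply: mq.
Qed.

Lemma measurable_minor g n : tupleF g -> (n <= p)%N ->
  measurable_fun [set: T] (fun x : T => \det (lead_block n (gram g x))).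
Proof.
move=> Fg np; rewrite /determinant; apply: measurable_sum => s.
apply: measurable_funM => //; apply: measurable_prod => i _.
under eq_fun do rewrite mxE.
by apply: mdens_measurable; apply: Fg; apply: leq_trans np.
Qed.

Lemma measurable_good g : tupleF g -> measurable (good g).
Proof.
move=> Fg; rewrite (_ : good g = \bigcup_(n in [set n | (n <= p)%N])
    ([set x : T | q x = (n%:R)%:E] `&` [set x | wdet p n (gram g x) != 0])).
  apply: bigcup_measurable => n /= np; apply: measurableI; first exact: measurable_index.
  rewrite (_ : [set _ | _] = (fun x : T => wdet p n (gram g x)) @^-1` (~` [set 0])).
    rewrite -[X in measurable X]setTI.
    have mw : measurable_fun [set: T] (fun x : T => wdet p n (gram g x)).
      apply: measurable_funM; first exact: measurable_minor.
      by apply: measurable_prod => i _; apply: mdens_measurable; exact: Fg.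
    by apply: mw => //; exact: measurableC.
  by apply/seteqP; split=> x /= /eqP.
apply/seteqP; split=> [x [n [np qx w]]|x [n np [qx w]]]; exists n => //.
Qed.

Definition perturb (t : R) h g (i : nat) : X -> R := h i \+ (fun y => t * g i y).

Lemma tupleF_perturb t h g : tupleF h -> tupleF g -> tupleF (perturb t h g).
Proof.
by move=> Fh Fg i ip; apply: (formD hF); [exact: Fh|apply: (formZ hF); exact: Fg].
Qed.

Lemma gram_perturb (t : R) h g : tupleF h -> tupleF g ->
  {ae nu, forall x : T, forall i, (i < p)%N -> forall j, (j < p)%N ->
    gram (perturb t h g) x i j = gram h x i j +
      (mdens rho (h i) (g j) x + mdens rho (g i) (h j) x) * t + gram g x i j * t ^+ 2}.
Proof.
move=> Fh Fg; apply: ae_forall_lt => i ip; apply: ae_forall_lt => j jp.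
exact: (mdens_quad lc sep met hF hreg hmu hrho t (Fh i ip) (Fg i ip) (Fh j jp) (Fg j jp)).
Qed.

(** Otherwise some u n, with energies of h - u n at most 2^-(n+1), lose mass e. Summability makes
    the densities of h - u n tend to 0 a.e., hence the Gram matrices of u n tend to that of h, and a
    good point of h is eventually good for u n. *)
Lemma good_lsc h (e : R) : tupleF h -> 0 < e ->
  exists2 d : R, 0 < d & forall h', tupleF h' ->
    (forall i, (i < p)%N -> E1 m E (h i \- h' i) < d) ->
    fine (kap (good h `\` good h')) < e.
Proof.
move=> Fh e0; apply: contrapT => H.
have ex n : exists h', [/\ tupleF h',
    (forall i, (i < p)%N -> energy mu setT (h i \- h' i) <= 1 / (2 ^ n.+1)%:R) &
    e <= fine (kap (good h `\` good h'))].
  have n0 : 0 < 1 / (2 ^ n.+1)%:R :> R by rewrite divr_gt0// ltr0n expn_gt0.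
  have [d d0 Hd] := energy_small lc sep met hF hreg hmu (@measurableT _ T) n0.
  apply: contrapT => Hn; apply: H; exists d => // h' Fh' hh'.
  rewrite ltNge; apply/negP => le; apply: Hn; exists h'; split=> // i ip.
  by apply/ltW/Hd; [apply: (formB hF); [exact: Fh|exact: Fh']|exact: hh'].
have [u Hu] := choice ex.
have Fu n : tupleF (u n) by case: (Hu n).
pose g n i := h i \- u n i.
have Fg n : tupleF (g n).
  by move=> i ip; apply: (formB hF); [exact: Fh|exact: Fu].
have uE n : u n = perturb (-1) h (g n).
  by apply/funext => i; apply/funext => x; rewrite /perturb /g/=; ring.
have a1 : {ae nu, forall x : T, forall n i, (i < p)%N -> forall j, (j < p)%N ->
    gram (u n) x i j = gram h x i j +
      (mdens rho (h i) (g n j) x + mdens rho (g n i) (h j) x) * (-1) +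
      gram (g n) x i j * (-1) ^+ 2}.
  by apply: ae_foralln => n; apply: filterS (gram_perturb (-1) Fh (Fg n)) => x; rewrite -uE.
have a2 : {ae nu, forall x : T, forall i, (i < p)%N -> rho (g n i) x @[n --> \oo] --> (0 : R)}.
  apply: ae_forall_lt => i ip; apply: ae_cvg0_of_summable.
  - by move=> n; apply: (dens_measurable hrho); exact: Fg.
  - by move=> n x; apply: (dens_ge0 hrho); exact: Fg.
  - move=> n; rewrite (dens_integral hmu hrho (Fg n i ip))// lee_fin.
    by case: (Hu n) => _ + _; exact.
have a3 : {ae nu, forall x : T, forall n i, (i < p)%N -> forall j, (j < p)%N -> forall k : nat,
    2 * `|mdens rho (g n i) (h j) x| <= k.+1%:R * rho (g n i) x + rho (h j) x / k.+1%:R}.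
  apply: ae_foralln => n; apply: ae_forall_lt => i ip; apply: ae_forall_lt => j jp.
  exact: (mdens_young lc sep met hF hreg hmu hrho (Fg n i ip) (Fh j jp)).
have a4 : {ae nu, forall x : T, forall n i, (i < p)%N -> forall j, (j < p)%N -> forall k : nat,
    2 * `|gram (g n) x i j| <= k.+1%:R * rho (g n i) x + rho (g n j) x / k.+1%:R}.
  apply: ae_foralln => n; apply: ae_forall_lt => i ip; apply: ae_forall_lt => j jp.
  exact: (mdens_young lc sep met hF hreg hmu hrho (Fg n i ip) (Fg n j jp)).
have mA n : measurable (good h `\` good (u n)).
  by apply: measurableD; exact: measurable_good.
have out : {ae kap, forall x : T, exists N, forall n, (N <= n)%N -> ~ (good h `\` good (u n)) x}.
  apply: (ae_dominated kapnu); apply: filterS2 (filterI a1 a2) (filterI a3 a4) => x [b1 b2] [b3 b4].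
  have [[n0 [np qx w]]|nh] := pselect (good h x); last by exists 0%N => n _ [].
  (* The density of h j stays fixed here, so all weights k are needed; for [small] both densities
     tend to 0 and the weight k = 0 is enough. *)
  have cross i j : (i < p)%N -> (j < p)%N ->
      mdens rho (g n i) (h j) x @[n --> \oo] --> (0 : R).
    move=> ip jp; apply: (@young_cvg0 _ (fun n => rho (g n i) x) _ (rho (h j) x)).
    - by apply: (dens_ge0 hrho); exact: Fh.
    - by move=> n; apply: (dens_ge0 hrho); exact: Fg.
    - exact: b2.
    - by move=> n k; exact: b3.
  have small i j : (i < p)%N -> (j < p)%N -> gram (g n) x i j @[n --> \oo] --> (0 : R).
    move=> ip jp; apply: norm_cvg0.
    apply: (@squeeze_cvgr _ _ _ _ (cst 0) (fun n => rho (g n i) x + rho (g n j) x)).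
    - near=> n; rewrite normr_ge0/=.
      have := b4 n i ip j jp 0%N; rewrite mul1r divr1.
      by have := normr_ge0 (gram (g n) x i j); lra.
    - exact: cvg_cst.
    - by rewrite -[X in _ --> X](addr0 (0 : R)); apply: cvgD; exact: b2.
  have cg i j : (i < p)%N -> (j < p)%N -> gram (u n) x i j @[n --> \oo] --> gram h x i j.
    move=> ip jp; rewrite (_ : (fun n => gram (u n) x i j) = (fun n => gram h x i j -
        (mdens rho (g n j) (h i) x + mdens rho (g n i) (h j) x) + gram (g n) x i j)).
      rewrite -[X in _ --> X]addr0; apply: cvgD; last exact: small.
      rewrite -[X in _ --> X]subr0; apply: cvgB; first exact: cvg_cst.
      by rewrite -[X in _ --> X](addr0 (0 : R)); apply: cvgD; exact: cross.
    by apply/funext => n; rewrite b1// (mdensC rho (h i)); ring.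
  have /cvgrPdist_lt cw := cvg_wdet np cg.
  have w0 : 0 < `|wdet p n0 (gram h x)| by rewrite normr_gt0.
  have [N _ HN] := cw _ w0; exists N => n /HN /= lt [_]; apply.
  exists n0; split=> //; apply/eqP => w1; move: lt.
  by rewrite w1 subr0 ltxx.
have [N /(_ N (leqnn N))] := ae_eventually_out_small kapfin mA out e0.
by case: (Hu N) => _ _ le; rewrite ltNge le.
Unshelve. all: by end_near.
Qed.

(** Up to a nonzero power of 1/(k+1), the weighted minor of h + g/(k+1) is that of g + (k+1) h: a
    polynomial in k+1 whose constant term is nonzero on [good g]. *)
Lemma good_perturb h g (e : R) : tupleF h -> tupleF g -> 0 < e ->
  exists N, forall k, (N <= k)%N ->
    fine (kap (good g `\` good (perturb k.+1%:R^-1 h g))) < e.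
Proof.
move=> Fh Fg e0.
have Fp k : tupleF (perturb k.+1%:R^-1 h g) by exact: tupleF_perturb.
apply: ae_eventually_out_small => //.
  by move=> k; apply: measurableD; exact: measurable_good.
have a1 : {ae nu, forall x : T, forall k i, (i < p)%N -> forall j, (j < p)%N ->
    gram (perturb k.+1%:R^-1 h g) x i j = gram h x i j +
      (mdens rho (h i) (g j) x + mdens rho (g i) (h j) x) * k.+1%:R^-1 +
      gram g x i j * k.+1%:R^-1 ^+ 2}.
  by apply: ae_foralln => k; exact: gram_perturb.
apply: (ae_dominated kapnu); apply: filterS a1 => x a1.
have [[n [np qx w]]|ng] := pselect (good g x); last by exists 0%N => k _ [].
pose B i j := mdens rho (h i) (g j) x + mdens rho (g i) (h j) x.
pose P := wdet p n (quad_poly (gram g x) B (gram h x)).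
have P0 : P != 0.
  apply/eqP => P0; move: w; rewrite (_ : wdet p n (gram g x) = P.[0]).
    by rewrite P0 horner0 eqxx.
  by rewrite horner_wdet_quad; apply: eq_wdet => // i j _ _; rewrite expr0n/= !mulr0 !addr0.
have inj : injective (fun k : nat => k.+1%:R : R).
  by move=> i j /eqP; rewrite eqr_nat => /eqP[].
have [N HN] := poly_eventually_neq0 P0 inj.
exists N => k /HN Pk [_]; apply; exists n; split=> //.
have -> : wdet p n (gram (perturb k.+1%:R^-1 h g) x) =
    (k.+1%:R^-1 ^+ 2) ^+ (n + p) * P.[k.+1%:R].
  rewrite horner_wdet_quad -wdetZ; apply: eq_wdet => // i j ip jp; rewrite a1// -/(B i j).
  have : (k.+1%:R : R) != 0 by rewrite pnatr_eq0.
  by move: (k.+1%:R) => b b0; field.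
by rewrite mulf_neq0// !expf_neq0// invr_eq0 pnatr_eq0.
Qed.

(** A tuple near h that is good almost wherever g or h is: a small multiple of g captures [good g],
    and semicontinuity preserves [good h]. *)
Lemma good_join h g (e d : R) : tupleF h -> tupleF g -> 0 < e -> 0 < d ->
  exists h', [/\ tupleF h', forall i, (i < p)%N -> E1 m E (h i \- h' i) < d,
    fine (kap (good g `\` good h')) < e & fine (kap (good h `\` good h')) < e].
Proof.
move=> Fh Fg e0 d0.
have [N HN] := good_perturb Fh Fg e0.
have [d1 d10 Hd1] := good_lsc Fh e0.
pose G := \sum_(i < p) E1 m E (g i).
have GE i : (i < p)%N -> E1 m E (g i) <= G.
  move=> ip; rewrite /G (bigD1 (Ordinal ip))//= lerDl sumr_ge0// => j _.
  by apply: (E1_ge0 hF); exact: Fg.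
have G0 : 0 <= G by apply: sumr_ge0 => i _; apply: (E1_ge0 hF); exact: Fg.
pose d2 := Num.min d d1; have d20 : 0 < d2 by rewrite lt_min d0.
(* Large enough for [good_perturb], and with G/(k+1) < d2 so that the perturbation stays inside both
   radii. *)
pose k := maxn N (Num.truncn (G / d2)).
pose s : R := k.+1%:R^-1.
have s0 : 0 < s by rewrite invr_gt0.
have s1 : s <= 1 by rewrite invf_le1// ler1n.
have sG : s * G < d2.
  rewrite mulrC ltr_pdivrMr// mulrC -ltr_pdivrMr//.
  apply: (@lt_le_trans _ _ (Num.truncn (G / d2)).+1%:R).
    by apply: truncnS_gt; rewrite num_real.
  by rewrite ler_nat ltnS leq_maxr.
have close i : (i < p)%N -> E1 m E (h i \- perturb s h g i) < d2.
  move=> ip; rewrite (_ : _ \- _ = (fun x => - s * g i x)).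
    rewrite (E1Z hF) ?sqrrN; last exact: Fg.
    apply: le_lt_trans sG; apply: ler_pM => //.
    - exact: sqr_ge0.
    - by apply: (E1_ge0 hF); exact: Fg.
    - by rewrite expr2 ler_piMl// ltW.
    - exact: GE.
  by apply/funext => x; rewrite /perturb/=; ring.
exists (perturb s h g); split.
- exact: tupleF_perturb.
- by move=> i /close; rewrite lt_min => /andP[].
- by apply: HN; exact: leq_maxl.
- apply: Hd1; first exact: tupleF_perturb.
  by move=> i /close; rewrite lt_min => /andP[].
Qed.

Lemma kap_split A B : measurable A -> measurable B ->
  fine (kap A) = fine (kap (A `&` B)) + fine (kap (A `\` B)).
Proof.
move=> mA mB; rewrite -fineD ?kap_fin//; last 2 first.
- exact: measurableI.
- exact: measurableD.
by rewrite addeC -measureDI.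
Qed.

Lemma kap_ge0 A : 0 <= fine (kap A).
Proof. exact: fine_ge0. Qed.

Lemma kap_le A B : measurable A -> measurable B -> A `<=` B -> fine (kap A) <= fine (kap B).
Proof.
by move=> mA mB AB; apply: fine_le; rewrite ?kap_fin//; apply: le_measure; rewrite ?inE.
Qed.

Lemma kap_le_diff A B : measurable A -> measurable B ->
  fine (kap A) <= fine (kap B) + fine (kap (A `\` B)).
Proof.
move=> mA mB; rewrite (kap_split mA mB) lerD2r; apply: kap_le => //.
exact: measurableI.
Qed.

Definition maximal h := forall g, tupleF g -> fine (kap (good g)) <= fine (kap (good h)).

(* A Baire-type construction: good_lsc makes "kap (good h) is within 1/k of the
   supremum" stable under small perturbations, good_join makes it dense. *)
Lemma maximal_dense (f : nat -> X -> R) (e : R) : tupleF f -> 0 < e ->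
  exists h, [/\ tupleF h, forall i, (i < p)%N -> E1 m E (f i \- h i) < e & maximal h].
Proof.
move=> Ff e0.
pose vals := [set fine (kap (good g)) | g in tupleF]; pose S := sup vals.
have supv : has_sup vals.
  split; first by exists (fine (kap (good f))), f.
  exists (fine (kap setT)) => _ [g Fg <-].
  by apply: kap_le => //; exact: measurable_good.
pose St := {hr : (nat -> X -> R) * R | tupleF hr.1 /\ 0 < hr.2}.
have step (a : nat * St) : exists st : St,
    [/\ forall i, (i < p)%N -> E1 m E ((sval a.2).1 i \- (sval st).1 i) < (sval a.2).2,
        4 * (sval st).2 <= (sval a.2).2,
        S - 2 * a.1.+1%:R^-1 < fine (kap (good (sval st).1)) &
        forall h, tupleF h -> (forall i, (i < p)%N ->
            E1 m E ((sval st).1 i \- h i) <= 8 * (sval st).2) ->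
          fine (kap (good (sval st).1 `\` good h)) < a.1.+1%:R^-1].
  case: a => k [[h r] /= [Fh r0]].
  have k0 : 0 < k.+1%:R^-1 :> R by rewrite invr_gt0.
  have [_ [g Fg <-] gS] := sup_adherent k0 supv.
  have [h' [Fh' hh' gh' _]] := good_join Fh Fg k0 r0.
  have [d d0 Hd] := good_lsc Fh' k0.
  (* r/4 feeds the geometric limit; d/9 puts the whole set of possible limits, at distance at most 8
     r', strictly inside the radius d. *)
  pose r' := Num.min (r / 4) (d / 9).
  have r'0 : 0 < r' by rewrite lt_min; apply/andP; split; lra.
  have [r'1 r'2] : r' <= r / 4 /\ r' <= d / 9.
    by split; rewrite ge_min lexx ?orbT.
  exists (exist _ (h', r') (conj Fh' r'0)); split=> //=.
  - lra.
  - have := kap_le_diff (measurable_good Fg) (measurable_good Fh').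
    move: gS gh'; rewrite -/S; move: (k.+1%:R^-1 : R) => c; lra.
  - move=> h'' Fh'' close; apply: Hd => // i ip.
    by apply: le_lt_trans (close i ip) _; lra.
have [nxt Hnxt] := choice step.
(* The limit is within 8 times the initial radius of f, and 8 e / 9 < e. *)
have r00 : 0 < e / 9 by lra.
pose st := nat_rect (fun=> St) (exist _ (f, e / 9) (conj Ff r00)) (fun k s => nxt (k, s)).
pose u k := (sval (st k)).1; pose r k := (sval (st k)).2.
have Fu k : tupleF (u k) by exact: (svalP (st k)).1.
have HS k := Hnxt (k, st k).
have lim_ex i : exists v, (i < p)%N -> F v /\ forall k, E1 m E (u k i \- v) <= 8 * r k.
  have [ip|ip] := ltnP i p; last by exists (fun=> 0).
  have [|||v Fv [_ Hv]] := @E1_geometric_limit _ _ _ _ _ hF (fun k => u k i) r.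
  - by move=> k; exact: Fu.
  - by move=> k; apply/ltW; case: (HS k) => + _ _ _; exact.
  - by move=> k; case: (HS k).
  - by exists v.
have [h Hh] := choice lim_ex.
have Fh : tupleF h by move=> i ip; case: (Hh i ip).
exists h; split=> //.
  by move=> i ip; have [_ /(_ 0%N)] := Hh i ip; rewrite /u /r/=; lra.
move=> g Fg; apply: (@le_trans _ _ S).
  by apply: ub_le_sup; [case: supv|exists g].
apply/ler_addgt0Pr => d d0.
(* Two units 1/(k+1) are lost between S and the stage k+1, one more between that stage and the
   limit. *)
have d3 : 0 < d / 3 by lra.
have /cvgrPdist_lt/(_ _ d3)[k _ /(_ k (leqnn k))] := @cvg_harmonic R.
rewrite /= sub0r normrN ger0_norm ?invr_ge0// => kd.
have [_ _ h1 /(_ h Fh) h2] := HS k.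
have h3 : fine (kap (good (u k.+1) `\` good h)) < k.+1%:R^-1.
  by apply: h2 => i ip; have [_ /(_ k.+1)] := Hh i ip.
have := kap_le_diff (measurable_good (Fu k.+1)) (measurable_good Fh).
move: h1 h3 kd; rewrite -[sval _]/(sval (st k.+1)) -/(u k.+1) /=.
move: (k.+1%:R^-1 : R) => c; lra.
Qed.

(** A join h' of h and g cannot beat the maximum, so what it gains over [good h] is at most what it
    loses there, which is arbitrarily small; almost all of [good g] minus [good h] lies in that
    gain. *)
Lemma maximal_absorbs h g : tupleF h -> maximal h -> tupleF g ->
  fine (kap (good g `\` good h)) = 0.
Proof.
move=> Fh maxh Fg; apply/eqP; rewrite eq_le kap_ge0 andbT.
apply/ler_addgt0Pr => e e0; rewrite add0r; have e2 : 0 < e / 2 by lra.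
have [h' [Fh' _ gh' hh']] := good_join Fh Fg e2 ltr01.
have [ma mb mc] : [/\ measurable (good g), measurable (good h) & measurable (good h')].
  by split; exact: measurable_good.
have := maxh h' Fh'.
have := kap_split mc mb; have := kap_split mb mc; rewrite setIC.
have : fine (kap (good g `\` good h)) <= fine (kap (good h' `\` good h)) +
    fine (kap ((good g `\` good h) `\` (good h' `\` good h))).
  by apply: kap_le_diff; exact: measurableD.
have : fine (kap ((good g `\` good h) `\` (good h' `\` good h))) <= fine (kap (good g `\` good h')).
  apply: kap_le; [by do ?apply: measurableD|exact: measurableD|].
  by move=> x [[gx nhx] nx]; split=> // h'x; apply: nx.
lra.
Qed.

(** * From maximality to good points almost everywhere *)

Context (nukap : nu `<< kap) (p_gt0 : (0 < p)%N).

(* Replacing g i by g i + g 0 / k makes every density nonzero where the leading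
   minor of g is nonzero, while keeping that minor nonzero for large k. *)
Lemma maximal_minor_eq0 h g : tupleF h -> maximal h -> tupleF g ->
  {ae nu, forall x : T, ~ good h x -> forall n, (0 < n <= p)%N -> q x = (n%:R)%:E ->
    \det (lead_block n (gram g x)) = 0}.
Proof.
move=> Fh maxh Fg; pose g0 (_ : nat) := g 0%N.
have Fg0 : tupleF g0 by move=> i _; exact: Fg.
pose Y : set T := ~` good h `&` \bigcup_(n in [set n | (0 < n <= p)%N])
  ([set x : T | q x = (n%:R)%:E] `&` [set x | \det (lead_block n (gram g x)) != 0]).
have mY : measurable Y.
  apply: measurableI; first by apply: measurableC; exact: measurable_good.
  apply: bigcup_measurable => n /= /andP[_ np]; apply: measurableI; first exact: measurable_index.
  rewrite (_ : [set _ | _] = (fun x : T => \det (lead_block n (gram g x))) @^-1` (~` [set 0])).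
    rewrite -[X in measurable X]setTI.
    by apply: (measurable_minor Fg np) => //; exact: measurableC.
  by apply/seteqP; split=> x /= /eqP.
pose gk k := perturb k.+1%:R^-1 g g0.
have Fgk k : tupleF (gk k) by exact: tupleF_perturb.
have a1 : {ae nu, forall x : T, forall k i, (i < p)%N -> forall j, (j < p)%N ->
    gram (gk k) x i j = gram g x i j +
      (mdens rho (g i) (g0 j) x + mdens rho (g0 i) (g j) x) * k.+1%:R^-1 +
      gram g0 x i j * k.+1%:R^-1 ^+ 2}.
  by apply: ae_foralln => k; exact: gram_perturb.
have a2 := mdens_diag lc sep met hF hreg hmu hrho (Fg 0%N p_gt0).
have a3 : {ae nu, forall x : T, forall j, (j < p)%N -> forall k : nat,
    2 * `|mdens rho (g 0%N) (g j) x| <= k.+1%:R * rho (g 0%N) x + rho (g j) x / k.+1%:R}.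
  apply: ae_forall_lt => j jp.
  exact: (mdens_young lc sep met hF hreg hmu hrho (Fg 0%N p_gt0) (Fg j jp)).
have out : {ae kap, forall x : T, exists N, forall k, (N <= k)%N -> ~ (Y `\` good (gk k)) x}.
  apply: (ae_dominated kapnu); apply: filterS2 (filterI a1 a2) a3 => x [b1 b2] b3.
  have [[_ [n /andP[n0 np] [qx /= det0]]]|nY] := pselect (Y x); last by exists 0%N => k _ [].
  (* If D(g_0, g_0) vanished, letting k grow in Young's inequality would kill D(g_0, g_j) for all j
     < p, hence the first row of the leading block, which exists as n > 0. *)
  have g00 : mdens rho (g 0%N) (g 0%N) x != 0.
    apply/eqP => g00; move/eqP: det0; apply.
    have row0 j : (j < p)%N -> mdens rho (g 0%N) (g j) x = 0.
      move=> jp.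
      have young k : 2 * `|mdens rho (g 0%N) (g j) x| <= k.+1%:R * 0 + rho (g j) x / k.+1%:R.
        by rewrite -g00 b2; exact: b3.
      have cv : mdens rho (g 0%N) (g j) x @[_ --> (\oo : set_system nat)] --> (0 : R).
        apply: (@young_cvg0 _ (fun=> 0) _ (rho (g j) x)) => //; last exact: cvg_cst.
        by apply: (dens_ge0 hrho); exact: Fg.
      by rewrite -(cvg_lim (@Rhausdorff R) cv) lim_cst.
    case: n n0 np qx => // n _ np _.
    rewrite (expand_det_row _ ord0); apply: big1 => j _.
    by rewrite mxE /gram row0 ?mul0r// (leq_trans (ltn_ord j)).
  pose B i j := mdens rho (g i) (g0 j) x + mdens rho (g0 i) (g j) x.
  pose P := wdet p n (quad_poly (gram g x) B (gram g0 x)).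
  (* The minor has nonzero value at 0, and each diagonal factor has the coefficient D(g_0, g_0) in
     degree 2. *)
  have P0 : P != 0.
    rewrite /P /wdet mulf_neq0//.
      apply/eqP => P0; move/eqP: det0; apply.
      transitivity (\det (lead_block n (quad_poly (gram g x) B (gram g0 x)))).[0].
        rewrite horner_det_quad; congr (\det _); apply/matrixP => i j.
        by rewrite !mxE expr0n/= !mulr0 !addr0.
      by rewrite P0 horner0.
    apply/prodf_neq0 => i _; apply/eqP => Q0.
    have : (quad_poly (gram g x) B (gram g0 x) i i)`_2 = 0 by rewrite Q0 coef0.
    rewrite /quad_poly !coefD coefC coefMX coefC/= coefMXn/= coefC/= !add0r.
    by move/eqP; rewrite (negbTE g00).
  have inj : injective (fun k : nat => k.+1%:R^-1 : R).
    by move=> i j /invr_inj/eqP; rewrite eqr_nat => /eqP[].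
  have [N HN] := poly_eventually_neq0 P0 inj.
  exists N => k /HN Pk [_]; apply; exists n; split=> //.
  rewrite (_ : wdet p n _ = P.[k.+1%:R^-1])// horner_wdet_quad.
  by apply: eq_wdet => // i j ip jp; rewrite b1.
have mYk k : measurable (Y `\` good (gk k)).
  by apply: measurableD => //; exact: measurable_good.
have Y0 : fine (kap Y) = 0.
  apply/eqP; rewrite eq_le kap_ge0 andbT; apply/ler_addgt0Pr => e e0; rewrite add0r.
  have [N /(_ N (leqnn N)) Ne] := ae_eventually_out_small kapfin mYk out e0.
  have mgN := measurable_good (Fgk N).
  rewrite (kap_split mY mgN).
  (* h is not good on Y, so the part of Y captured by [gk N] is null by maximality. *)
  have : fine (kap (Y `&` good (gk N))) <= fine (kap (good (gk N) `\` good h)).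
    apply: kap_le; [exact: measurableI|apply: measurableD => //; exact: measurable_good|].
    by move=> x [[nh _] gx].
  by rewrite maximal_absorbs//; lra.
apply: (ae_dominated nukap); exists Y; split=> //.
  by rewrite -[LHS]fineK ?kap_fin// Y0.
move=> x /=; apply: contra_notP => nYx nh n np qx.
apply: contra_notP nYx => /eqP det0; split=> //; exists n => //.
Qed.

Context (q_bound : pw_index_bound F nu rho q)
  (q_min : forall q', pw_index_bound F nu rho q' -> {ae nu, forall x : T, (q x <= q' x)%E}).

(** At a point of rank n some principal n x n minor is nonzero, but the functions it involves depend
    on the point. Lists over 'I_N are countable, so the vanishing of all minors holds outside one
    null set. *)
Lemma maximal_rank_lt h (N : nat) (fs : 'I_N -> X -> R) : tupleF h -> maximal h ->
  (forall i, F (fs i)) ->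
  {ae nu, forall x : T, ~ good h x -> forall n, (0 < n <= p)%N -> q x = (n%:R)%:E ->
    (\rank (emat rho fs x) < n)%N}.
Proof.
move=> Fh maxh Ffs; pose gl (l : seq 'I_N) i := nth (fun=> 0) (map fs l) i.
have Fgl l : tupleF (gl l).
  move=> i _; rewrite /gl; have [il|il] := ltnP i (size (map fs l)).
    by rewrite size_map in il; case: l il => // a l il; rewrite (nth_map a).
  by rewrite nth_default//; exact: (form0 hF).
have a1 : {ae nu, forall x : T, forall c l, unpickle c = Some l ->
    ~ good h x -> forall n, (0 < n <= p)%N -> q x = (n%:R)%:E ->
    \det (lead_block n (gram (gl l) x)) = 0}.
  apply: ae_foralln => c; case: (unpickle c) => [l|]; last exact: aeW.
  by apply: filterS (maximal_minor_eq0 Fh maxh (Fgl l)) => x H l' [<-].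
case: q_bound => _ _ /(_ N fs Ffs) a2.
apply: filterS2 a1 a2 => x b1 b2 nh n np qx; rewrite ltnNge; apply/negP => le.
have rkn : n = \rank (emat rho fs x).
  by apply/eqP; rewrite eqn_leq le/=; move: b2; rewrite qx lee_fin ler_nat.
have sym : (emat rho fs x)^T = emat rho fs x.
  by apply/matrixP => i j; rewrite !mxE mdensC.
have [f det0] := sym_principal_minor sym.
pose l := [seq f i | i <- enum 'I_(\rank (emat rho fs x))].
have := b1 (pickle l) l (pickleK l) nh n np qx; rewrite rkn => /eqP; apply/negP.
rewrite (_ : lead_block _ _ = \matrix_(i, j) emat rho fs x (f i) (f j))//.
have nthl (i : 'I_(\rank (emat rho fs x))) : gl l i = fs (f i).
  by rewrite /gl /l -map_comp (nth_map i) ?size_enum_ord// nth_ord_enum.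
by apply/matrixP => i j; rewrite !mxE /gram !nthl.
Qed.

Context (nu_medm : medm F mu nu) (q_le : {ae nu, forall x : T, (q x <= (p%:R)%:E)%E}).

(** Every energy density vanishes a.e. where q = 0, so nu restricted to the complement still
    dominates all energy measures; minimality of nu makes that set null. *)
Lemma index_neq0 : {ae nu, forall x : T, q x <> 0%E}.
Proof.
case: nu_medm => -[G GT mG] _ numin.
have m0 : measurable [set x : T | q x = 0%E] by exact: (measurable_index 0).
have mD : measurable (~` [set x : T | q x = 0%E]) by exact: measurableC.
pose nu' : {measure set T -> \bar R} := mrestr nu mD.
have nu'E A : nu' A = nu (A `&` ~` [set x : T | q x = 0%E]) by [].
have /null_content_dominatesP dom : nu `<< nu'.
  apply: numin.
    exists G => // i; have [mGi Gi] := mG i; split=> //.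
    by apply: le_lt_trans Gi; apply: le_measure; rewrite ?inE//; exact: measurableI.
  move=> f Ff; apply/null_content_dominatesP => A mA A0.
  have [mrf _ ->//] := hrho Ff.
  have z1 : {ae nu, forall x : T, q x = 0%E -> rho f x = 0}.
    case: q_bound => _ _ /(_ 1%N (fun=> f) (fun=> Ff)) a1.
    have a2 := mdens_diag lc sep met hF hreg hmu hrho Ff.
    apply: filterS2 a1 a2 => x b1 b2 qx; move: b1; rewrite qx lee_fin lern0.
    rewrite mxrank_eq0 => /eqP/matrixP/(_ ord0 ord0); rewrite !mxE => <-.
    by rewrite b2.
  have z2 : {ae nu, forall x : T, A x -> q x = 0%E}.
    exists (A `&` ~` [set x : T | q x = 0%E]); split; [|exact: A0|]; first exact: measurableI.
    by move=> x /= /not_implyP[].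
  rewrite (@ae_eq_integral _ _ _ nu A (cst 0%E)) ?integral0//.
    by apply/measurable_EFinP; apply: measurable_funTS.
  by apply: filterS2 z1 z2 => x b1 b2 Ax; rewrite b1//; exact: b2.
exists [set x : T | q x = 0%E]; split=> //.
  by apply: dom => //; rewrite [LHS]nu'E setICr measure0.
by move=> x /= /contrapT.
Qed.

Lemma maximal_good h : tupleF h -> maximal h -> {ae nu, forall x, good h x}.
Proof.
move=> Fh maxh; case: q_bound => _ q_val q_rank.
pose B : set T := ~` good h `&` \bigcup_(n in [set n | (0 < n <= p)%N])
  [set x : T | q x = (n%:R)%:E].
have mB : measurable B.
  apply: measurableI; first by apply: measurableC; exact: measurable_good.
  by apply: bigcup_measurable => n _; exact: measurable_index.
pose q' x := (q x - (\1_B x)%:E)%E.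
have q'in x n : B x -> q x = (n%:R)%:E -> q' x = (n%:R - 1)%:E.
  by move=> Bx qx; rewrite /q' qx indicE mem_set.
have q'out x : ~ B x -> q' x = q x.
  by move=> nBx; rewrite /q' indicE memNset// sube0.
have bnd : pw_index_bound F nu rho q'.
  split.
  - apply: emeasurable_funB => //; apply/measurable_EFinP; exact: measurable_indic.
  - move=> x; have [Bx|nBx] := pselect (B x); last by rewrite q'out.
    have [_ [n /andP[n0 _] /= qx]] := Bx; right; exists n.-1.
    by rewrite (q'in _ _ Bx qx) -{1}(prednK n0) -natr1 addrK.
  - move=> N fs Ffs.
    apply: filterS2 (q_rank N fs Ffs) (maximal_rank_lt Fh maxh Ffs) => x b1 b2.
    have [Bx|nBx] := pselect (B x); last by rewrite q'out.
    have [nh [n np /= qx]] := Bx; rewrite (q'in _ _ Bx qx) lee_fin lerBrDr natr1 ler_nat.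
    exact: b2.
(* A bad point has finite index since q <= p, and nonzero index a.e., so it falls in B, where q <=
   q' fails. *)
apply: filterS2 (filterI (q_min bnd) q_le) index_neq0 => x [qq' qp] q0.
apply: contrapT => nh.
have [qy|[n qn]] := q_val x; first by rewrite qy in qp.
have np : (0 < n <= p)%N.
  rewrite lt0n; apply/andP; split; first by apply/eqP => n0; apply: q0; rewrite qn n0.
  by move: qp; rewrite qn lee_fin ler_nat.
have Bx : B x by split=> //; exists n.
by move: qq'; rewrite (q'in _ _ Bx qn) qn lee_fin; lra.
Qed.

(** Nonzero D(h_i, h_i) a.e. gives nu << mu_<h_i>, so mu_<h_i> dominates whatever nu does; it is
    minimal because a competitor must dominate mu_<h_i> itself. *)
Lemma good_setGhat h : tupleF h -> {ae nu, forall x, good h x} ->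
  setGhat F mu nu rho q p h.
Proof.
move=> Fh gh; split.
  split=> //; apply: filterS gh => x [n [np qx w]] n'; rewrite qx => -[/eqP].
  rewrite eqr_nat => /eqP <-.
  by move: w; rewrite /wdet mulf_eq0 negb_or => /andP[+ _]; rewrite unitmxE unitfE.
move=> i ip; have Fhi := Fh i ip; case: nu_medm => nusf nudom numin.
have fin : (mu (h i) setT < +oo)%E by case: hmu => + _ _; exact.
have nuh : nu `<< mu (h i).
  apply/null_content_dominatesP => A mA A0.
  have [mrf _ muE] := hrho Fhi.
  have : (\int[nu]_(x in A) `|(rho (h i) x)%:E| = 0)%E.
    under eq_integral do rewrite gee0_abs ?lee_fin ?(dens_ge0 hrho)//.
    by rewrite -muE.
  move=> /(ae_eq_integral_abs nu mA) z.
  have {}z : {ae nu, forall x : T, A x -> (rho (h i) x)%:E = 0%E}.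
    by apply: z; apply/measurable_EFinP; exact: measurable_funTS.
  have d := mdens_diag lc sep met hF hreg hmu hrho Fhi.
  apply/negligibleP => //; have : {ae nu, forall x : T, ~ A x}.
    apply: filterS2 (filterI gh d) z => x [[n [np qx w]] dx] zx /zx [] r0.
    move: w; rewrite /wdet mulf_eq0 negb_or => /andP[_ /prodf_neq0/(_ (Ordinal ip) isT)].
    by rewrite /gram/= dx r0 eqxx.
  by apply: negligibleS => x Ax /=; exact.
split.
- exists (fun=> setT); first by rewrite bigcup_const//; exists 0%N.
  by move=> k; split.
- by move=> f Ff; apply: null_dominates_trans (nudom f Ff) nuh.
- by move=> nu' _; exact.
Qed.

End good_points.

Theorem theorem3p1 (R : realType) (X : ptopologicalType)
  (m : {measure set (borel X) -> \bar R})
  (E : (X -> R) -> (X -> R) -> R) (F : set (X -> R))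
  (mu : (X -> R) -> {measure set (borel X) -> \bar R})
  (nu : {measure set (borel X) -> \bar R})
  (rho : (X -> R) -> X -> R) (q : borel X -> \bar R) (p : nat) :
  locally_compact [set: X] -> separable_space X -> metrizable R X ->
  radon_full_support m ->
  dirichlet_form m E F -> regular_form m E F -> strongly_local m E F ->
  energy_measures m E F mu ->
  medm F mu nu ->
  densities F mu nu rho ->
  pointwise_index F nu rho q ->
  ess_sup nu q = (p%:R)%:E -> (1 <= p)%N ->
  dense_in_Fp m E F p (setG F nu rho q p) /\
  dense_in_Fp m E F p (setGhat F mu nu rho q p).
Proof.
move=> lc sep met _ hF hreg _ hmu nu_medm hrho [qb qmin] qp p0.
have [nusf _ _] := nu_medm; have [mq _ _] := qb.
have [kap [kapfin kapnu nukap]] := sigma_finite_equiv_finite nusf.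
have q_le : {ae nu, forall x, (q x <= (p%:R)%:E)%E} by rewrite -qp; exact: ess_sup_ge.
have dense : dense_in_Fp m E F p (setGhat F mu nu rho q p).
  move=> f Ff e e0.
  have [h [Fh fh maxh]] :=
    maximal_dense lc sep met hF hreg hmu hrho mq kapfin kapnu Ff e0.
  exists h => //; apply: (good_setGhat lc sep met hF hreg hmu hrho nu_medm Fh).
  exact: (maximal_good lc sep met hF hreg hmu hrho mq kapfin kapnu nukap p0 qb qmin
    nu_medm q_le Fh maxh).
split=> // f Ff e e0; have [h [Gh _] fh] := dense f Ff e e0; exists h => //.
Qed.
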